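(* Let $\Omega=\{\alpha,\sigma\alpha,\sigma^2\alpha\}\subset\{1,2,3\}^{\mathbb Z}$, where $\alpha$ is the bi-infinite periodic sequence $\alpha_k=(k \bmod 3)+1$ (i.e. $\ldots123123\ldots$ with $\alpha_0=1$), $\sigma$ is the left shift and $p$ is the uniform probability on $\Omega$. There exist three piecewise-affine expanding maps $T_1,T_2,T_3:S^1\to S^1$ with a common Markov partition $\mathcal B$ such that the map cocycle $\Phi$ over $(\Omega,\sigma)$ generated by $\{T_1,T_2,T_3\}$, with associated Perron--Frobenius cocycle $\mathcal P$, has the following properties for $i=1,2,3$: (i) each $T_i$ preserves Lebesgue measure; (ii) $\vartheta(\omega)=\log(1/3)$ for all $\omega\in\Omega$; (iii) the restriction $\mathcal P_i|_{\chi(\mathcal B)}$ of the Perron--Frobenius operator of $T_i$ has no exceptional eigenvalues; (iv) $\mathcal P(\omega)$ has an exceptional Lyapunov spectrum that is independent of $\omega$ and satisfies $$\Lambda(\mathcal P(\omega))\cap(\vartheta,0)\supset\left\{\log\left(\frac{\sqrt[3]{8\pm 2\sqrt{11}}}{3}\right)\right\};$$ (v) the Oseledets subspace $\mathcal W_2(\omega)$ corresponding to the largest exceptional Lyapunov exponent exists for all $\omega\in\Omega$ and depends only on $\omega_0$.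
   Context: $S^1=\mathbb R/\mathbb Z$, identified with $[0,1)$; $m$ is Lebesgue measure. A map $T:S^1\to S^1$ is an expanding map if there is a finite partition $0=a_0<a_1<\dots<a_M=1$ such that on each $(a_{i-1},a_i)$, $T$ is continuous and extends to a $C^2$ map on $[a_{i-1},a_i]$ with $|DT|>1$; it is piecewise-affine if moreover $DT$ is constant on each $(a_{i-1},a_i)$. Its Perron--Frobenius operator is $\mathcal P f(x)=\sum_{y\in T^{-1}(x)} f(y)/|DT(y)|$. $\mathrm{BV}$ is the Banach space of real $f\in L^\infty(m)$ with $\mathrm{var} f:=\inf\{\mathrm{var}_{S^1} g: g=f \text{ a.e.}\}<\infty$, with norm $\|f\|=\max\{\|f\|_{L^1},\mathrm{var} f\}$. A partition $\mathcal B=\{B_1,\dots,B_M\}$ of $S^1$ into intervals is a Markov partition for $T$ if $B_i\cap T(B_j)\ne\emptyset$ implies $B_i\subset T(B_j)$; it is a common Markov partition for a family if it is Markov for each member. $\chi(\mathcal B)$ is the $M$-dimensional space of functions constant on each $B_k$; it is invariant under each $\mathcal P_i$. For maps $\{T_i\}_{i\in Z_K}$, $Z_K=\{1,\dots,K\}$, and a shift-invariant $\Omega\subset Z_K^{\mathbb Z}$ with left shift $(\sigma\omega)_k=\omega_{k+1}$, the map cocycle is $\Phi^{(n)}(\omega)=T_{\omega_{n-1}}\circ\cdots\circ T_{\omega_0}$ and the Perron--Frobenius cocycle is $\mathcal P^{(n)}(\omega)=\mathcal P_{\omega_{n-1}}\cdots\mathcal P_{\omega_0}$ on $\mathrm{BV}$,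 $\mathcal P_i$ being the Perron--Frobenius operator of $T_i$. Lyapunov exponent: $\lambda(\omega,f)=\limsup_{n\to\infty}\frac1n\log\|\mathcal P^{(n)}(\omega)f\|$; Lyapunov spectrum $\Lambda(\mathcal P(\omega))=\{\lambda(\omega,f):f\in\mathrm{BV}\}$. Essential upper bound: $\vartheta(\omega)=-\inf_{x}\limsup_{n}\frac1n\log|D\Phi^{(n)}(\omega)(x)|$ (written $\vartheta$ when independent of $\omega$). Exceptional Lyapunov exponents are elements of $\Lambda(\mathcal P(\omega))$ in $(\vartheta(\omega),0)$. For a single expanding map $T$ with Perron--Frobenius operator $\mathcal P$ on $\mathrm{BV}$, put $\theta=\lim_n\sup_x|D(T^n)(x)|^{-1/n}$ (the essential spectral radius); an eigenvalue of $\mathcal P$ is exceptional if it differs from $1$ and has modulus $>\theta$. Oseledets subspaces: writing $f\in\chi(\mathcal B)$ as $\langle v\rangle=\sum_k v_k\chi_{B_k}$, $v\in\mathbb R^M$, the cocycle $\mathcal P(\omega)|_{\chi(\mathcal B)}$ is represented by a matrix cocycle $A(\omega)$ on $\mathbb R^M$; an Oseledets decomposition at $\omega$ is a splitting $\mathbb R^M=\bigoplus_{j=1}^\ell W_j(\omega)$ with $A(\omega)W_j(\omega)\subseteq W_j(\sigma\omega)$ (equality if $\lambda_j>-\infty$) and $\lim_n\frac1n\log\|A(\sigma^{n-1}\omega)\cdots A(\omega)v\|=\lambda_j$ for $v\in W_j(\omega)\setminus\{0\}$, where $\lambda_1>\lambda_2>\cdots>\lambda_\ell$; $\mathcal W_j(\omega)=\{\langle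 v\rangle: v\in W_j(\omega)\}$, and $\mathcal W_2(\omega)$ is the one for the second largest exponent $\lambda_2$. *)

(* Defs.v *)
From HB Require Import structures.
From mathcomp Require Import all_boot all_order all_algebra.
From mathcomp Require Import all_classical all_reals all_analysis.
From mathcomp Require Import complex.
Set Implicit Arguments. Unset Strict Implicit. Unset Printing Implicit Defensive.
Import numFieldNormedType.Exports.
Import Order.TTheory GRing.Theory Num.Theory.
Local Open Scope ring_scope.
Local Open Scope classical_set_scope.

Section Defs.
Variable R : realType.

(* S^1 = R/Z is identified with [0,1). *)
Definition I01 : set R := [set x | 0 <= x < 1].

Definition fracR (x : R) : R := x - (Num.floor x)%:~R.

(* Data of a piecewise-affine expanding map: partition
   0 = a 0 < a 1 < ... < a M = 1, and on the i-th piece (a i, a (i+1))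
   (i < M) the map is x |-> c i + s i * x  (mod 1), with slope s i. *)
Record pa_data := PaData {
  pa_M : nat; pa_a : nat -> R; pa_s : nat -> R; pa_c : nat -> R }.

Definition in_piece (d : pa_data) (i : nat) (x : R) : bool :=
  (i < pa_M d)%N && (pa_a d i < x < pa_a d i.+1).

Definition regular_pt (d : pa_data) (x : R) : Prop := exists i, in_piece d i x.

Definition is_pa_expanding (T : R -> R) (d : pa_data) : Prop :=
  [/\ (0 < pa_M d)%N, pa_a d 0 = 0, pa_a d (pa_M d) = 1 &
      (forall i, (i < pa_M d)%N -> pa_a d i < pa_a d i.+1)] /\
  [/\
      (forall i, (i < pa_M d)%N -> 1 < `|pa_s d i|),
      (forall i x, in_piece d i x -> T x = fracR (pa_c d i + pa_s d i * x)) &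
      (forall x, I01 x -> I01 (T x))].

Definition dslope (d : pa_data) (x : R) : R :=
  \sum_(i < pa_M d) (if in_piece d i x then pa_s d i else 0).

(* Perron--Frobenius operator: P f(x) = sum_{y in T^-1 x} f(y)/|DT(y)|
   (preimages taken in the open pieces; the finitely many breakpoints
   form a null set, irrelevant on L^oo classes). *)
Definition pfop (T : R -> R) (d : pa_data) (f : R -> R) : R -> R :=
  fun x => \sum_(i < pa_M d)
     (\sum_(y \in [set y | in_piece d i y /\ T y = x]) (f y / `|pa_s d i|)).

Definition preserves_leb (T : R -> R) : Prop :=
  forall A : set R, measurable A -> A `<=` I01 ->
    (@lebesgue_measure R) (I01 `&` (T @^-1` A)) = (@lebesgue_measure R) A.

Definition sshift (w : int -> nat) : int -> nat := fun k => w (k + 1)%R.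
Definition alpha_seq : int -> nat := fun k => (absz (k %% 3)%Z).+1.
Definition Omega3 : set (int -> nat) :=
  [set w | w = alpha_seq \/ w = sshift alpha_seq \/ w = sshift (sshift alpha_seq)].

Fixpoint Phi (T : nat -> R -> R) (w : int -> nat) (n : nat) (x : R) : R :=
  match n with 0%N => x | n'.+1 => T (w n'%:Z) (Phi T w n' x) end.

Definition DPhi (T : nat -> R -> R) (d : nat -> pa_data) (w : int -> nat)
  (n : nat) (x : R) : R :=
  \prod_(k < n) dslope (d (w k%:Z)) (Phi T w k x).

(* points of S^1 whose forward orbit never meets a breakpoint
   (where D Phi^(n) is defined for all n) *)
Definition regular_orbit (T : nat -> R -> R) (d : nat -> pa_data)
  (w : int -> nat) (x : R) : Prop :=
  I01 x /\ forall k : nat, regular_pt (d (w k%:Z)) (Phi T w k x).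

Definition elog (r : R) : \bar R := if r == 0 then -oo%E else (ln r)%:E.
Definition eplog (x : \bar R) : \bar R :=
  match x with EFin r => elog r | +oo%E => +oo%E | -oo%E => -oo%E end.

Definition ess_upper (T : nat -> R -> R) (d : nat -> pa_data)
  (w : int -> nat) : \bar R :=
  (- ereal_inf [set limn_esup (fun n : nat =>
        ((n%:R)^-1)%:E * elog `|DPhi T d w n x|)%E
     | x in regular_orbit T d w])%E.

(* essential spectral radius of a single map:
   theta = lim_n sup_x |D(T^n)(x)|^(-1/n) *)
Definition theta_map (T : R -> R) (d : pa_data) : R :=
  limn (fun n : nat =>
    sup [set `|DPhi (fun _ => T) (fun _ => d) (fun _ => 0%N) n x| `^ (- (n%:R)^-1)
        | x in regular_orbit (fun _ => T) (fun _ => d) (fun _ => 0%N)]).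

Definition ae_eq (f g : R -> R) : Prop :=
  {ae @lebesgue_measure R, forall x, I01 x -> f x = g x}.

(* variation on the circle: sup over cyclically ordered points
   0 <= x_0 < x_1 < ... < x_n < 1 *)
Definition cvar (g : R -> R) : \bar R :=
  ereal_sup [set v | exists (n : nat) (x : nat -> R),
     [/\ 0 <= x 0%N, (forall k, (k < n)%N -> x k < x k.+1), x n < 1 &
        v = ((\sum_(k < n) `|g (x k.+1) - g (x k)|) + `|g (x 0%N) - g (x n)|)%:E]].

Definition evar (f : R -> R) : \bar R :=
  ereal_inf [set cvar g | g in [set g | ae_eq f g]].

Definition L1norm (f : R -> R) : \bar R :=
  (\int[@lebesgue_measure R]_(x in I01) (`|f x|)%:E)%E.

Definition bvnorm (f : R -> R) : \bar R := maxe (L1norm f) (evar f).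

Definition inBV (f : R -> R) : Prop :=
  [/\ measurable_fun I01 f,
      (exists K : R, {ae @lebesgue_measure R, forall x, I01 x -> `|f x| <= K}) &
      (evar f < +oo)%E].

Fixpoint PFn (T : nat -> R -> R) (d : nat -> pa_data) (w : int -> nat)
  (n : nat) (f : R -> R) : R -> R :=
  match n with 0%N => f
  | n'.+1 => pfop (T (w n'%:Z)) (d (w n'%:Z)) (PFn T d w n' f) end.

Definition lyap (T : nat -> R -> R) (d : nat -> pa_data) (w : int -> nat)
  (f : R -> R) : \bar R :=
  limn_esup (fun n : nat => ((n%:R)^-1)%:E * eplog (bvnorm (PFn T d w n f)))%E.

Definition lyap_spectrum T d w : set (\bar R) := [set lyap T d w f | f in inBV].

Definition exc_spectrum T d w : set (\bar R) :=
  [set mu | lyap_spectrum T d w mu /\ (ess_upper T d w < mu)%E /\ (mu < 0)%E].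

(* partition of S^1 into the intervals B_k = (b k, b (k+1)), k < Mb,
   with 0 = b 0 < ... < b Mb = 1 (endpoints are a null set) *)
Definition Bint (b : nat -> R) (k : nat) : set R := [set x | b k < x < b k.+1].

Definition is_partition (b : nat -> R) (Mb : nat) : Prop :=
  [/\ (0 < Mb)%N, b 0%N = 0, b Mb = 1 & forall k, (k < Mb)%N -> b k < b k.+1].

Definition is_markov (T : R -> R) (b : nat -> R) (Mb : nat) : Prop :=
  forall j k, (j < Mb)%N -> (k < Mb)%N ->
    Bint b k `&` (T @` Bint b j) !=set0 -> Bint b k `<=` T @` Bint b j.

Definition vecfun (b : nat -> R) (Mb : nat) (v : 'rV[R]_Mb) : R -> R :=
  fun x => \sum_(k < Mb) v 0 k * (if b k < x < b k.+1 then 1 else 0).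

Definition represents (T : R -> R) (d : pa_data) (b : nat -> R) (Mb : nat)
  (A : 'M[R]_Mb) : Prop :=
  forall v : 'rV[R]_Mb, ae_eq (pfop T d (vecfun b v)) (vecfun b (v *m A)).

Definition no_exc_eigenvalue (Mb : nat) (A : 'M[R]_Mb) (theta : R) : Prop :=
  forall l : R[i], eigenvalue (map_mx (fun r : R => (r%:C)%C) A) l ->
    l = 1 \/ (`|l| <= (theta%:C)%C).

Definition vnorm (n : nat) (v : 'rV[R]_n) : R := \big[Num.max/0]_(k < n) `|v 0 k|.

Fixpoint mcocycle (Mb : nat) (Amat : nat -> 'M[R]_Mb) (w : int -> nat) (n : nat)
  : 'M[R]_Mb :=
  match n with 0%N => 1%:M | n'.+1 => mcocycle Amat w n' *m Amat (w n'%:Z) end.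

(* A family W(w)_j (j < l, as row spaces) over the sshift-invariant set Om is an
   Oseledets decomposition with exponents lam 0 > lam 1 > ... > lam (l-1). *)
Definition oseledets (Mb : nat) (Amat : nat -> 'M[R]_Mb) (Om : set (int -> nat))
  (l : nat) (lam : nat -> \bar R) (W : (int -> nat) -> nat -> 'M[R]_Mb) : Prop :=
  (forall j, (j.+1 < l)%N -> (lam j.+1 < lam j)%E) /\
  forall w, Om w ->
    [/\ (\sum_(j < l) W w j :=: 1%:M)%MS,
        mxdirect (\sum_(j < l) W w j) &
        forall j, (j < l)%N ->
          [/\ W w j != 0,
              (W w j *m Amat (w 0) <= W (sshift w) j)%MS,
              (lam j != -oo)%E -> (W w j *m Amat (w 0) :=: W (sshift w) j)%MS &
              forall v : 'rV[R]_Mb, (v <= W w j)%MS -> v != 0 ->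
                (fun n : nat => ((n%:R)^-1)%:E * elog (vnorm (v *m mcocycle Amat w n)))%E
                  @ \oo --> lam j]].

End Defs.

(* Main.v *)
From Pilot Require Import Defs.
From HB Require Import structures.
From mathcomp Require Import all_boot all_order all_algebra.
From mathcomp Require Import all_classical all_reals all_analysis.
From mathcomp Require Import complex.
From mathcomp Require Import measurable_realfun ring lra zify.
Import numFieldNormedType.Exports.
Import Order.TTheory GRing.Theory Num.Theory.
Import Pilot.Defs.
Local Open Scope ring_scope.
Local Open Scope classical_set_scope.
Set Implicit Arguments.
Unset Strict Implicit.
Unset Printing Implicit Defensive.

(** All maps are affine of slope 3 on 45 pieces of length 1/45, each piece being stretched over
one of M = 15 equal cells, so that the transfer matrices are [A_i = N_i / 3] with [N_i] a
nonnegative integer matrix.  For each phase [i] the cells are grouped into five blocks of three,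
and [T_i] stretches every cell over a block of the grouping number [i + 1], that is
[N_i = L_i R_{i+1}] with 0-1 matrices of rank 5.  A product of the [A_i] along the cycle is then
governed by the 5 x 5 matrices [C_i = R_i L_i], whose product has the eigenvalues
27, 8 + 2 sqrt 11, 2, 8 - 2 sqrt 11 and 0, whereas a single [A_i] only sees
[S_i = R_{i+1} L_i], chosen so that [S_i ^ 2 = 2 J - 1] with [J] the all-ones matrix: this leaves
only the eigenvalues 1, 0 and the two imaginary numbers of modulus 1/3.

For the exponents on BV: the operators contract the variation inside the cells by 1/3, so the
values [q_n] of the iterates at the left end points of the cells obey
[q_(n+1) = q_n A + O(3^-n)].  In the coordinates dual to the Oseledets vectors this is a scalar
recursion [x_(n+1) = rho x_n + O(3^-n)] with [rho > 1/3], hence [x_n = rho^n z + O(3^-n)]; the norm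
of the iterates grows like the power of the largest [rho] with [z <> 0], or at most like 3^-n if
all the [z] vanish. *)

(** * Growth rates *)

(** The exceptional spectrum has to be determined completely: the second Oseledets exponent must
    dominate the exceptional exponent of every function in BV, so exhibiting eigenfunctions is not
    enough and an arbitrary [f] needs an upper bound. This works because two thresholds coincide.
    The errors decay like [3^-n], which is also the rate of the essential upper bound, so a mode can
    be separated from the errors as soon as its rate exceeds that bound, and the remainder is
    [O(3^-n)] without a polynomial factor. The eigenvalue 2 of the cycle yields a further
    exceptional exponent, between the two required ones. The eigenvalue 0 and the kernel due to the
    rank 5 get no coordinates: six steps of the cocycle annihilate their contribution, which is also
    where the exponent minus infinity comes from. Single maps and cycle can have unrelated spectra
    because [L_i] meets the next grouping in the spectrum of [N_i], but its own grouping inside the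
    cycle product. *)

Section Growth.
Variable R : realType.
Implicit Types (u v : nat -> \bar R) (c rho : R).

Lemma cvg_ln_geometric c rho : 0 < c -> 0 < rho ->
  (((n%:R)^-1)%:E * (ln (c * rho ^+ n))%:E)%E @[n --> \oo] --> (ln rho)%:E.
Proof.
move=> c0 r0.
have H : (n%:R^-1 * ln c + ln rho) @[n --> \oo] --> ln rho.
  rewrite -[X in _ --> X]add0r -[X in _ --> X + _](mul0r (ln c)).
  apply: cvgD; last exact: cvg_cst.
  apply: cvgM; last exact: cvg_cst.
  by apply/gtr0_cvgV0; [near=> n; rewrite ltr0n; near: n; exact: nbhs_infty_gt|exact: cvgr_idn].
apply: (@cvg_trans _ ((n%:R^-1 * ln c + ln rho)%:E @[n --> \oo])); last first.
  by apply: cvg_EFin => /=; [exact: nearW|exact: H].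
apply: near_eq_cvg; near=> n.
rewrite -EFinM lnM ?posrE ?exprn_gt0// lnXn// mulrDr -[ln rho *+ n]mulr_natl mulrA mulVf ?mul1r//.
by rewrite pnatr_eq0 -lt0n; near: n; exact: nbhs_infty_gt.
Unshelve. all: end_near. Qed.

Lemma growth_rate u c1 c2 rho : 0 < c1 -> 0 < c2 -> 0 < rho ->
  (\forall n \near \oo, ((c1 * rho ^+ n)%:E <= u n <= (c2 * rho ^+ n)%:E)%E) ->
  (((n%:R)^-1)%:E * eplog (u n))%E @[n --> \oo] --> (ln rho)%:E.
Proof.
move=> c10 c20 r0 H.
apply: (squeeze_cvge _ (cvg_ln_geometric c10 r0) (cvg_ln_geometric c20 r0)).
near=> n.
have : ((c1 * rho ^+ n)%:E <= u n <= (c2 * rho ^+ n)%:E)%E by near: n.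
case: (u n) => [r| |] /andP[]//; rewrite !lee_fin => h1 h2.
have p1 : 0 < c1 * rho ^+ n by rewrite mulr_gt0 ?exprn_gt0.
have r1 : 0 < r by exact: lt_le_trans h1.
rewrite /eplog /elog gt_eqF// -!EFinM !lee_fin !ler_wpM2l ?invr_ge0 ?ler_ln ?posrE//.
exact: lt_le_trans h2.
Unshelve. all: end_near. Qed.

(** The limit superior is an infimum, over the sets of the filter, of suprema; each such set may be
    cut down to the part where the inequality holds. *)
Lemma limn_esup_le_near u v : (\forall n \near \oo, (u n <= v n)%E) ->
  (limn_esup u <= limn_esup v)%E.
Proof.
move=> H; rewrite /limn_esup !limf_esupE; apply: le_ereal_inf_tmp => _ [V Voo <-].
apply: (@le_trans _ _ (ereal_sup [set u n | n in V `&` [set n | (u n <= v n)%E]])).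
  by apply: ereal_inf_lbound; exists (V `&` [set n | (u n <= v n)%E]) => //; exact: filterI.
by apply: ge_ereal_sup => _ [n [Vn uv] <-]; apply: (le_trans uv); apply: ereal_sup_ubound; exists n.
Qed.

Lemma growth_rate_le u c rho : 0 < c -> 0 < rho ->
  (\forall n \near \oo, (0 <= u n <= (c * rho ^+ n)%:E)%E) ->
  (limn_esup (fun n => ((n%:R)^-1)%:E * eplog (u n)) <= (ln rho)%:E)%E.
Proof.
move=> c0 r0 H.
have [_ <-] := cvg_limn_einf_sup (cvg_ln_geometric c0 r0).
apply: limn_esup_le_near; near=> n.
have n0 : (0 < n)%N by near: n; exact: nbhs_infty_gt.
have : (0 <= u n <= (c * rho ^+ n)%:E)%E by near: n.
case: (u n) => [r| |] /andP[]//; rewrite !lee_fin => h1 h2.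
(* A vanishing term has logarithm minus infinity, which stays below every bound since [n] is
   positive. *)
rewrite /eplog /elog; case: eqVneq => [_|r1].
  by rewrite mulrNy gtr0_sg ?mul1e ?leNye// invr_gt0 ltr0n.
have r2 : 0 < r by rewrite lt_neqAle eq_sym r1.
rewrite -!EFinM !lee_fin ler_wpM2l ?invr_ge0 ?ler_ln ?posrE//.
exact: lt_le_trans h2.
Unshelve. all: end_near. Qed.

End Growth.

(** * Affine images of null sets and bounds on the L1 norm *)

Section Affine.
Variable R : realType.
Local Notation mu := (@lebesgue_measure R).

Definition affpre (s c : R) (A : set R) : set R := [set x | A (s * x + c)].

Lemma measurable_affine (s c : R) : measurable_fun [set: R] (fun x : R => s * x + c).
Proof. by apply: measurable_funD => //; exact: measurable_funM. Qed.

Lemma measurable_affpre (s c : R) (A : set R) : measurable A -> measurable (affpre s c A).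
Proof. by move=> mA; rewrite -[affpre _ _ _]setTI; exact: measurable_affine. Qed.

(** Multiplied by [s], the image measure under [x |-> s x + c] gives half-open intervals their
    length, so it is Lebesgue measure by uniqueness. *)
Lemma lebesgue_measure_affpre (s c : R) (A : set R) : 0 < s -> measurable A ->
  mu (affpre s c A) = ((s^-1)%:E * mu A)%E.
Proof.
move=> s0 mA.
have [nu nuE] : exists nu : {measure set (measurableTypeR R) -> \bar R},
    forall A, nu A = mu (affpre s c A).
  pose f : measurableTypeR R -> measurableTypeR R := fun x : R => s * x + c.
  unshelve eexists (pushforward mu f : {measure set (measurableTypeR R) -> \bar R}).
    exact: measurable_affine.
  by [].
pose mu' := mscale (NngNum (ltW s0)) nu.
suff -> : mu A = mu' A.
  rewrite (_ : mu' A = (s%:E * nu A)%E)//.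
  by rewrite nuE muleA -EFinM mulVf ?gt_eqF// mul1e.
apply: lebesgue_measure_unique => // _ [[a b]] _ <-.
transitivity (s%:E * nu `]a, b]%classic)%E; last by [].
rewrite nuE.
have -> : affpre s c `]a, b] = `](a - c) / s, (b - c) / s]%classic.
  apply/seteqP; split => x /=; rewrite !in_itv/= ltr_pdivrMr// ler_pdivlMr// ltrBlDr lerBrDr mulrC//.
rewrite !lebesgue_measure_itv /= !lte_fin ltr_pM2r ?invr_gt0// ltrD2r.
case: ifPn => _; last by rewrite mule0.
by rewrite -!EFinB -EFinM; congr (_%:E); field; rewrite gt_eqF.
Qed.

Lemma negligible_affpre (s c : R) (N : set R) : 0 < s -> mu.-negligible N ->
  mu.-negligible (affpre s c N).
Proof.
move=> s0 [B [mB B0 NB]]; exists (affpre s c B); split.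
- exact: measurable_affpre.
- by rewrite lebesgue_measure_affpre// [X in (_ * X)%E]B0 mule0.
- by move=> x /NB.
Qed.

Lemma ae_affpre (s c : R) (P : R -> Prop) : 0 < s ->
  {ae mu, forall x, P x} -> {ae mu, forall x, P (s * x + c)}.
Proof. by move=> s0; exact: negligible_affpre. Qed.

Lemma ae_mono2 (P Q S : R -> Prop) : (forall x, P x -> Q x -> S x) ->
  {ae mu, forall x, P x} -> {ae mu, forall x, Q x} -> {ae mu, forall x, S x}.
Proof.
move=> PQS NP NQ; apply: negligibleS (negligibleU NP NQ) => x /= nS.
by apply: contra_notP nS => /not_orP[/contrapT Px /contrapT Qx]; exact: PQS.
Qed.

End Affine.

Section L1Bounds.
Variable R : realType.
Local Notation mu := (@lebesgue_measure R).
Import HBNNSimple.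

(** Both integrals are suprema over the simple functions below the integrand, and a simple function
    below the first integrand is below the second. This serves iterates whose measurability is not
    tracked. *)
Lemma integral_le_pointwise (D1 D2 : set R) (f1 f2 : R -> \bar R) : D1 `<=` D2 ->
  (forall x, D1 x -> (0 <= f1 x <= f2 x)%E) -> (forall x, D2 x -> (0 <= f2 x)%E) ->
  (\int[mu]_(x in D1) f1 x <= \int[mu]_(x in D2) f2 x)%E.
Proof.
move=> D12 f12 f20.
rewrite !ge0_integralE//; last by move=> x /f12/andP[].
apply: ereal_sup_le => _ [h hf <-]; exists h => //= x.
apply: le_trans (hf x) _; rewrite /patch.
case: ifPn => [/set_mem D1x|_]; last by case: ifPn => // /set_mem; exact: f20.
by rewrite mem_set; [have /andP[] := f12 _ D1x|exact: D12].
Qed.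

Lemma measurable_I01 : measurable (@I01 R).
Proof.
rewrite (_ : @I01 R = `[0, 1[%classic); first exact: measurable_itv.
by apply/seteqP; split => x /=; rewrite in_itv.
Qed.

Lemma lebesgue_measure_I01 : mu (@I01 R) = 1%E.
Proof.
rewrite (_ : @I01 R = `[0, 1[%classic); last by apply/seteqP; split => x /=; rewrite in_itv.
by rewrite lebesgue_measure_itv/= lte_fin ltr01 sube0.
Qed.

Lemma L1norm_ge0 (f : R -> R) : (0 <= L1norm f)%E.
Proof. by apply: integral_ge0 => x _; rewrite lee_fin. Qed.

(** The almost everywhere comparison is carried out for the simple functions below [|f|], which are
    measurable, against [B] times the indicator of the circle. *)
Lemma L1norm_le (f : R -> R) (B : R) : 0 <= B ->
  {ae mu, forall x, I01 x -> `|f x| <= B} -> (L1norm f <= B%:E)%E.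
Proof.
move=> B0 H; rewrite /L1norm ge0_integralE//; apply: ge_ereal_sup => _ [h hf <-].
have -> : sintegral mu h = (\int[mu]_(x in [set: R]) (h x)%:E)%E.
  by rewrite integral_nnsfun// patch_setT.
have Hle : (\int[mu]_(x in [set: R]) (h x)%:E <= \int[mu]_(x in [set: R]) (B%:E * (\1_(@I01 R) x)%:E))%E.
  apply: ae_ge0_le_integral => //.
  - by move=> x _; rewrite lee_fin fun_ge0.
  - by apply/measurable_EFinP.
  - by move=> x _; rewrite -EFinM lee_fin mulr_ge0.
  - apply/measurable_EFinP; apply: measurable_funM => //.
    exact: measurable_indic measurable_I01.
  apply: negligibleS H => x /= nh bx; apply: nh => _.
  apply: le_trans (hf x) _; rewrite /patch -EFinM indicE.
  by case: ifPn => [/set_mem/bx|_]; rewrite lee_fin ?mulr1 ?mulr0.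
apply: (le_trans Hle); rewrite ge0_integralZl//; last first.
  by apply/measurable_EFinP; exact: measurable_indic measurable_I01.
rewrite integral_indic//; last exact: measurable_I01.
by rewrite setIT [X in (_ * X)%E]lebesgue_measure_I01 mule1.
Qed.

(** Cutting the exceptional null set out of the interval keeps its measure and makes the bound
    pointwise. *)
Lemma L1norm_ge (f : R -> R) (c a b : R) : 0 <= c -> 0 <= a -> a < b -> b <= 1 ->
  {ae mu, forall x, a < x < b -> c <= `|f x|} -> ((c * (b - a))%:E <= L1norm f)%E.
Proof.
move=> c0 a0 ab b1 [N [mN N0 H]].
pose E := (`]a, b[%classic : set R).
have mE : measurable E by exact: measurable_itv.
have mEN : measurable (E `\` N) by exact: measurableD.
have -> : ((c * (b - a))%:E = c%:E * mu (E `\` N))%E.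
  have e : mu E = (b - a)%:E by rewrite /E lebesgue_measure_itv/= lte_fin ab.
  rewrite EFinM; congr (_ * _)%E; rewrite -e; apply/eqP; rewrite eq_le.
  apply/andP; split; last by apply: le_measure; rewrite ?inE//; exact: subDsetl.
  apply: (@le_trans _ _ (mu ((E `\` N) `|` N))).
    apply: le_measure; rewrite ?inE//; first exact: measurableU.
    by move=> x Ex; have [Nx|nNx] := pselect (N x); [right|left].
  have := measureU2 (@lebesgue_measure R : {measure set (measurableTypeR R) -> \bar R}) mEN mN.
  by rewrite [X in (_ <= _ + X)%E]N0 adde0.
rewrite -integral_cst//; apply: integral_le_pointwise.
- move=> x [Ex _]; move: Ex; rewrite /E/= in_itv/= /I01/= => /andP[ax xb].
  by rewrite (le_trans a0 (ltW ax)) (lt_le_trans xb b1).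
- move=> x [Ex nN]; move: Ex; rewrite /E/= in_itv/= => axb; rewrite !lee_fin c0/=.
  by apply: contrapT => h; apply: nN; apply: H => /= /(_ axb).
- by move=> x _; rewrite lee_fin.
Qed.

End L1Bounds.

(** * The maps in cell coordinates *)

Section BranchMap.
Variables (R : realType) (M : nat) (t : nat -> nat).
Hypothesis M_gt0 : (0 < M)%N.
Local Notation mu := (@lebesgue_measure R).

(** The truncation is the number [p] of the piece of length [1/(3M)] containing [x]; the shift is
    chosen so that this piece is stretched onto the cell number [t p]. *)
Definition bmap (x : R) : R :=
  3 * x + ((t (Num.truncn ((3 * M)%:R * x)))%:R - (Num.truncn ((3 * M)%:R * x))%:R) / M%:R.

Definition bdata : pa_data R :=
  PaData (3 * M) (fun p => p%:R / (3 * M)%:R) (fun=> 3)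
    (fun p => ((t p)%:R - p%:R) / M%:R).

Definition pt (N k : nat) (u : R) : R := (k%:R + u) / N%:R.
Definition idx (x : R) : nat := Num.truncn (M%:R * x).
Definition off (x : R) : R := M%:R * x - (idx x)%:R.
Definition assemble (G : nat -> R -> R) (x : R) : R := G (idx x) (off x).
(* The Perron-Frobenius operator in the coordinates [x = (k + u) / M]; with half-open cells it
   needs no exception at the breakpoints, where it may differ from [pfop]. *)
Definition Lop (G : nat -> R -> R) (k : nat) (u : R) : R :=
  3^-1 * \sum_(p < 3 * M | t p == k) G (p %/ 3)%N (((p %% 3)%:R + u) / 3).

Let M_neq0 : M%:R != 0 :> R. Proof. by rewrite pnatr_eq0 -lt0n. Qed.
Let K_gt0 : (0 < 3 * M)%N. Proof. by rewrite muln_gt0. Qed.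

Lemma truncn_pt (N k : nat) (u : R) : (0 < N)%N -> 0 <= u < 1 ->
  Num.truncn (N%:R * pt N k u) = k.
Proof.
move=> N0 /andP[u0 u1]; apply: truncn_def; rewrite /pt mulrC divfK ?pnatr_eq0 -?lt0n//.
by rewrite lerDl u0 -natr1 ltrD2l.
Qed.

Lemma idx_pt k u : 0 <= u < 1 -> idx (pt M k u) = k.
Proof. exact: truncn_pt. Qed.

Lemma off_pt k u : 0 <= u < 1 -> off (pt M k u) = u.
Proof. by move=> u01; rewrite /off idx_pt// /pt; field. Qed.

Lemma assemble_pt G k u : 0 <= u < 1 -> assemble G (pt M k u) = G k u.
Proof. by move=> u01; rewrite /assemble idx_pt// off_pt. Qed.

Lemma ptI01 (N k : nat) (u : R) : (k < N)%N -> 0 <= u < 1 -> I01 (pt N k u).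
Proof.
move=> kN /andP[u0 u1]; have N0 : 0 < N%:R :> R by rewrite ltr0n (leq_trans _ kN).
rewrite /I01/= /pt divr_ge0 ?addr_ge0//= ltr_pdivrMr// mul1r.
by apply: (@lt_le_trans _ _ k.+1%:R); rewrite ?ler_nat// -natr1 ltrD2l.
Qed.

Lemma I01_pt (N : nat) (x : R) : (0 < N)%N -> I01 x ->
  exists k u, [/\ (k < N)%N, 0 <= u < 1 & x = pt N k u].
Proof.
move=> N0 /andP[x0 x1]; have NR : 0 < N%:R :> R by rewrite ltr0n.
have y0 : 0 <= N%:R * x by rewrite mulr_ge0.
exists (Num.truncn (N%:R * x)), (N%:R * x - (Num.truncn (N%:R * x))%:R); split.
- by rewrite truncn_lt_nat// -[ltRHS]mulr1 ltr_pM2l.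
- by have /andP[h1 h2] := truncn_itv y0; rewrite subr_ge0 h1 ltrBlDr addrC natr1.
- by rewrite /pt subrKC mulrC mulKf// gt_eqF.
Qed.

(** Piece [p] is the third number [p %% 3] of the cell [p %/ 3]: this links the pieces of the map to
    the Markov cells. *)
Lemma pt_refine p u : pt (3 * M) p u = pt M (p %/ 3) (((p %% 3)%:R + u) / 3).
Proof.
rewrite /pt {1}(divn_eq p 3) natrD !natrM; field.
by rewrite M_neq0.
Qed.

Lemma refine01 p (u : R) : 0 <= u < 1 -> 0 <= ((p %% 3)%:R + u) / 3 < 1.
Proof. by move=> u01; have := ptI01 (ltn_pmod p (isT : 0 < 3)%N) u01. Qed.

Lemma bmap_pt p u : 0 <= u < 1 -> bmap (pt (3 * M) p u) = pt M (t p) u.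
Proof.
by move=> u01; rewrite /bmap truncn_pt// /pt natrM; field; rewrite M_neq0.
Qed.

Lemma in_pieceE p x :
  in_piece bdata p x <-> (p < 3 * M)%N /\ exists2 u, 0 < u < 1 & x = pt (3 * M) p u.
Proof.
have K0 : 0 < (3 * M)%:R :> R by rewrite ltr0n.
rewrite /in_piece /=; split.
  move=> /andP[pK /andP[h1 h2]]; split => //.
  exists ((3 * M)%:R * x - p%:R).
    move: h1 h2; rewrite ltr_pdivrMr// ltr_pdivlMr// -natr1 => h1 h2.
    by rewrite subr_gt0 mulrC h1 ltrBlDr addrC.
  by rewrite /pt subrKC mulrC mulKf// gt_eqF.
move=> [-> [u /andP[u0 u1] ->]] /=.
by rewrite /pt ltr_pM2r ?invr_gt0// ltrDl u0 ltr_pM2r ?invr_gt0// -natr1 ltrD2l.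
Qed.

Lemma pt_inj (N k k' : nat) (u u' : R) : (0 < N)%N -> 0 <= u < 1 -> 0 <= u' < 1 ->
  pt N k u = pt N k' u' -> k = k' /\ u = u'.
Proof.
move=> N0 u01 u01' e.
have kk : k = k' by rewrite -(truncn_pt k N0 u01) e truncn_pt.
split => //; move: e; rewrite kk /pt => /(mulIf _) => /(_ _)/addrI ->//.
by rewrite invr_eq0 pnatr_eq0 -lt0n.
Qed.

(** A piece is mapped bijectively onto a cell with relative position preserved, so it holds one
    preimage or none. Positive [u] keeps the preimages off the breakpoints, which [pfop] leaves
    out. *)
Lemma pfop_pt f k u : 0 < u < 1 ->
  pfop bmap bdata f (pt M k u) = 3^-1 * \sum_(p < 3 * M | t p == k) f (pt (3 * M) p u).
Proof.
move=> /andP[u0 u1]; have u01 : 0 <= u < 1 by rewrite ltW.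
rewrite /pfop big_distrr/= [RHS]big_mkcond /=; apply: eq_bigr => p _.
rewrite ger0_norm//; case: eqP => [tp|tp].
  rewrite (_ : [set y | _] = [set pt (3 * M) p u]).
    by rewrite fsbig_set1 mulrC.
  apply/seteqP; split => y /=.
    move=> [/in_pieceE[_ [v /andP[v0 v1] ->]]]; rewrite bmap_pt ?ltW//.
    by move=> /(pt_inj M_gt0) []//; rewrite ?ltW// => _ ->.
  move=> ->; rewrite bmap_pt ?tp//; split => //; apply/in_pieceE; split => //.
  by exists u => //; rewrite u0.
rewrite (_ : [set y | _] = set0) ?fsbig_set0//.
apply/seteqP; split => y //= [/in_pieceE[_ [v /andP[v0 v1] ->]]].
rewrite bmap_pt ?ltW//.
by move=> /(pt_inj M_gt0) []//; rewrite ?ltW.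
Qed.

Lemma ae_off_gt0 : {ae mu, forall x, forall k : nat, x != pt M k 0}.
Proof.
apply: ae_foralln => k; exists [set pt M k 0]; split => //.
  exact: lebesgue_measure_set1.
by move=> x /= /negP; rewrite negbK => /eqP.
Qed.

(** The null set where [f] differs from its model is pulled back along each inverse branch, an
    affine map of slope 1/3; the countable union of these null sets and the cell ends is
    discarded. *)
Lemma pfop_ae f G : ae_eq f (assemble G) -> ae_eq (pfop bmap bdata f) (assemble (Lop G)).
Proof.
move=> fG.
have H : {ae mu, forall x, forall p : nat, let y := 3^-1 * x + (p%:R - (t p)%:R) / (3 * M)%:R in
    I01 y -> f y = assemble G y}.
  by apply: ae_foralln => p; apply: (@ae_affpre _ _ _ (fun y => I01 y -> f y = assemble G y)).
apply: ae_mono2 H ae_off_gt0 => x H xb /(I01_pt M_gt0)[k [u [kM u01 xE]]].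
have u0 : 0 < u < 1.
  move: u01 => /andP[u0 ->]; rewrite andbT lt_neqAle u0 andbT.
  by apply: contraNneq (xb k) => e; rewrite xE -e.
rewrite xE pfop_pt// assemble_pt// /Lop; congr (_ * _); apply: eq_bigr => p /eqP tp.
rewrite -(assemble_pt _ _ (refine01 p u01)) -pt_refine.
have -> : pt (3 * M) p u = 3^-1 * x + (p%:R - (t p)%:R) / (3 * M)%:R.
  by rewrite xE tp /pt natrM; field; rewrite M_neq0.
apply: H.
have -> : 3^-1 * x + (p%:R - (t p)%:R) / (3 * M)%:R = pt (3 * M) p u.
  by rewrite xE tp /pt natrM; field; rewrite M_neq0.
exact: ptI01.
Qed.

End BranchMap.

(** * Contraction of the variation inside cells *)

Section Control.
Variables (R : realType) (M : nat).
Implicit Types (G H : nat -> R -> R) (D : R).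

(* Bounds the variation of [G] inside the cells, [H] playing the role of the variation function;
   quantifying over all [u] and [v] avoids suprema and makes the contraction by [Lop] a
   computation with finite sums. *)
Definition controlled G H D :=
  (forall k u v, (k < M)%N -> 0 <= u -> u <= v -> v < 1 -> `|G k v - G k u| <= H k v - H k u) /\
  (forall u v : nat -> R, (forall k, (k < M)%N -> [/\ 0 <= u k, u k <= v k & v k < 1]) ->
     \sum_(k < M) (H k (v k) - H k (u k)) <= D).

Lemma sum_triples (F : nat -> R) :
  \sum_(p < 3 * M) F p = \sum_(j < M) (F (3 * j)%N + F (3 * j).+1 + F (3 * j).+2).
Proof.
elim: M => [|m IH]; first by rewrite muln0 !big_ord0.
rewrite [RHS]big_ord_recr/= -IH mulnS addnC !addnS addn0 !big_ord_recr /=.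
by rewrite -!addrA.
Qed.

(** The slope gives the factor 1/3. The pieces are permuted among the cells, but the increments of
    [H] over them can be regrouped by the cell they come from, where three consecutive thirds fit
    into one increment; the total therefore does not grow. *)
Lemma controlled_Lop (t : nat -> nat) G H D : (forall p, (p < 3 * M)%N -> (t p < M)%N) ->
  controlled G H D -> controlled (Lop M t G) (Lop M t H) (D / 3).
Proof.
move=> t_lt [GH HD]; split.
  move=> k u v kM u0 uv v1; rewrite /Lop -!mulrBr -!sumrB normrM ger0_norm ?invr_ge0//.
  rewrite ler_wpM2l ?invr_ge0//; apply: le_trans (ler_norm_sum _ _ _) _.
  apply: ler_sum => p _; apply: GH.
  - by rewrite ltn_divLR// [(M * 3)%N]mulnC.
  - by have /andP[] := refine01 p (introT andP (conj u0 (le_lt_trans uv v1))).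
  - by rewrite ler_pM2r ?invr_gt0// lerD2l.
  - by have /andP[] := refine01 p (introT andP (conj (le_trans u0 uv) v1)).
move=> u v uv; rewrite /Lop.
under eq_bigr do rewrite -mulrBr -sumrB.
rewrite -mulr_sumr mulrC ler_pM2r ?invr_gt0//.
pose F (p : nat) := H (p %/ 3)%N (((p %% 3)%:R + v (t p)) / 3) - H (p %/ 3)%N (((p %% 3)%:R + u (t p)) / 3).
have -> : \sum_(k < M) \sum_(p < 3 * M | t p == k)
    (H (p %/ 3)%N (((p %% 3)%:R + v k) / 3) - H (p %/ 3)%N (((p %% 3)%:R + u k) / 3)) =
    \sum_(p < 3 * M) F p.
  rewrite (exchange_big_dep xpredT)//=; apply: eq_bigr => p _.
  by rewrite (big_pred1 (Ordinal (t_lt p (ltn_ord p))))// => k; rewrite /= -val_eqE/= eq_sym.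
rewrite sum_triples.
(* The left end lies in the first third of cell [j] and the right end in the last; the gaps between
   the three increments are nonnegative because [H j] is monotone. *)
pose u' j := u (t (3 * j)%N) / 3; pose v' j := (2 + v (t (3 * j).+2)) / 3.
have w p j : (p < 3)%N -> (j < M)%N -> [/\ 0 <= u (t (3 * j + p)%N),
    u (t (3 * j + p)%N) <= v (t (3 * j + p)%N) & v (t (3 * j + p)%N) < 1].
  by move=> p3 jM; apply: uv; apply: t_lt; lia.
have wE j : (j < M)%N -> [/\ [/\ 0 <= u (t (3 * j)%N), u (t (3 * j)%N) <= v (t (3 * j)%N) & v (t (3 * j)%N) < 1],
   [/\ 0 <= u (t (3 * j).+1), u (t (3 * j).+1) <= v (t (3 * j).+1) & v (t (3 * j).+1) < 1] &
   [/\ 0 <= u (t (3 * j).+2), u (t (3 * j).+2) <= v (t (3 * j).+2) & v (t (3 * j).+2) < 1]].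
  move=> jM; move: (w 0 _ isT jM) (w 1 _ isT jM) (w 2 _ isT jM).
  by rewrite addn0 addn1 addn2.
apply: le_trans (HD u' v' _); last first.
  move=> j /wE[[? ? ?] [? ? ?] [? ? ?]]; rewrite /u' /v'; split; lra.
apply: ler_sum => j _.
have [[a1 a2 a3] [b1 b2 b3] [c1 c2 c3]] := wE _ (ltn_ord j).
have -> : F (3 * j)%N = H j (v (t (3 * j)%N) / 3) - H j (u (t (3 * j)%N) / 3).
  by rewrite /F mulKn// mulnC modnMl !add0r.
have -> : F (3 * j).+1 = H j ((1 + v (t (3 * j).+1)) / 3) - H j ((1 + u (t (3 * j).+1)) / 3).
  by rewrite /F -[X in (X %/ 3)%N]addn1 -[X in (X %% 3)%N]addn1 mulnC divnMDl// modnMDl addn0.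
have -> : F (3 * j).+2 = H j ((2 + v (t (3 * j).+2)) / 3) - H j ((2 + u (t (3 * j).+2)) / 3).
  by rewrite /F -[X in (X %/ 3)%N]addn2 -[X in (X %% 3)%N]addn2 mulnC divnMDl// modnMDl addn0.
have mono x y : 0 <= x -> x <= y -> y < 1 -> H j x <= H j y.
  by move=> x0 xy y1; rewrite -subr_ge0; apply: le_trans (GH j _ _ (ltn_ord j) x0 xy y1).
have h1 : H j (v (t (3 * j)%N) / 3) <= H j ((1 + u (t (3 * j).+1)) / 3) by apply: mono; lra.
have h2 : H j ((1 + v (t (3 * j).+1)) / 3) <= H j ((2 + u (t (3 * j).+2)) / 3) by apply: mono; lra.
rewrite /u' /v'; lra.
Qed.

Lemma controlled_incr G H D k u v : controlled G H D -> (k < M)%N -> 0 <= u -> u <= v -> v < 1 ->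
  H k v - H k u <= D.
Proof.
move=> [GH HD] kM u0 uv v1.
have := HD (fun i => if i == k then u else 0) (fun i => if i == k then v else 0).
rewrite (bigD1 (Ordinal kM))//= eqxx big1 ?addr0.
  by apply => i _; case: eqP => _; split.
by move=> i /negPf; rewrite -val_eqE/= => ->; rewrite subrr.
Qed.

Lemma controlled_osc G H D k u v : controlled G H D -> (k < M)%N -> 0 <= u -> u <= v -> v < 1 ->
  `|G k v - G k u| <= D.
Proof.
move=> GHD kM u0 uv v1; apply: le_trans (controlled_incr GHD kM u0 uv v1).
by case: GHD => GH _; exact: GH.
Qed.

End Control.

(** * Variation on the circle and the BV norm *)

Section BVBounds.
Variables (R : realType).
Local Notation mu := (@lebesgue_measure R).
Implicit Types (g h : R -> R).

(** The increments along the chain telescope to at most [B]; the term closing the circle costs a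
    second [B]. *)
Lemma cvar_le g h B : (forall x y, 0 <= x -> x < y -> y < 1 -> `|g y - g x| <= h y - h x) ->
  (forall x y, 0 <= x -> x < y -> y < 1 -> h y - h x <= B) -> 0 <= B ->
  (cvar g <= (2 * B)%:E)%E.
Proof.
move=> gh hB B0; apply: ge_ereal_sup => _ [n [x [x0 xx x1 ->]]]; rewrite lee_fin.
have x_mono k : (k <= n)%N -> x 0%N <= x k.
  by elim: k => // k IH kn; rewrite (le_trans (IH (ltnW kn)))// ltW// xx.
have x_lt1 k : (k <= n)%N -> x k < 1.
  move=> kn; have : x k <= x n.
    move: kn; elim: (n) xx => [|m IH] xx'; first by rewrite leqn0 => /eqP->.
    rewrite leq_eqVlt => /orP[/eqP->//|]; rewrite ltnS => km.
    by rewrite (le_trans (IH _ km)) ?ltW ?xx'// => i im; apply: xx'; rewrite ltnS ltnW.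
  by move=> /le_lt_trans; exact.
have tel : \sum_(k < n) `|g (x k.+1) - g (x k)| <= h (x n) - h (x 0%N).
  rewrite -(telescope_sumr (fun k => h (x k)) (leq0n n)) big_mkord; apply: ler_sum => k _; apply: gh.
  - by rewrite (le_trans x0)// x_mono// ltnW.
  - exact: xx.
  - exact: x_lt1.
have [n0|n0] := posnP n.
  by rewrite n0 big_ord0 subrr normr0 addr0 mulr_ge0.
have xlt : x 0%N < x n.
  by case: n n0 xx x_mono {x1 x_lt1 tel} => // m _ xx xm; rewrite (le_lt_trans (xm m (leqnSn _)))// xx.
have c1 := hB _ _ x0 xlt x1; have c2 := gh _ _ x0 xlt x1.
by rewrite distrC in c2; lra.
Qed.

Let chains g (e : R) : set R := [set s | exists (n : nat) (y : nat -> R),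
  [/\ 0 <= y 0%N, (forall k, (k < n)%N -> y k < y k.+1), y n = e &
      s = \sum_(k < n) `|g (y k.+1) - g (y k)|]].
Let vset g (x : R) : set R := [set s | exists2 e, e <= x & chains g e s].

Let chain_ext g e z s : e < z -> chains g e s -> chains g z (s + `|g z - g e|).
Proof.
move=> ez [n [y [y0 yy ye ->]]].
exists n.+1, (fun k => if (k <= n)%N then y k else z); split => //.
- move=> k /=; rewrite ltnS => kn; have [->|ne] := eqVneq k n; first by rewrite leqnn ltnn ye.
  have kn' : (k < n)%N by rewrite ltn_neqAle ne.
  by rewrite kn kn'; exact: yy.
- by rewrite ltnn.
- rewrite big_ord_recr/= leqnn ltnn ye; congr (_ + _); apply: eq_bigr => k _.
  by rewrite (ltnW (ltn_ord k)) ltn_ord.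
Qed.

(** [h x] is the classical variation function, the supremum of the sums over chains in [[0, x]]; the
    increment from [x] to [y] is gained by prolonging a chain. *)
Lemma variation_control g : (cvar g < +oo)%E -> exists h V, [/\ 0 <= V,
  (forall x y, 0 <= x -> x <= y -> y < 1 -> `|g y - g x| <= h y - h x) &
  (forall x, 0 <= x -> x < 1 -> 0 <= h x <= V)].
Proof.
move=> gfin.
have g0 : (0 <= cvar g)%E.
  apply: ereal_sup_ubound; exists 0%N, (fun=> 0); split => //.
  by rewrite big_ord0 subrr normr0 addr0.
pose V := fine (cvar g).
have gV : cvar g = V%:E by rewrite fineK// ge0_fin_numE.
have V0 : 0 <= V by rewrite fine_ge0.
have sV x s : x < 1 -> vset g x s -> s <= V.
  move=> x1 [e ex [n [y [y0 yy ye ->]]]]; rewrite -lee_fin -gV.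
  apply: le_trans (ereal_sup_ubound _); last first.
    by exists n, y; split => //; rewrite ye (le_lt_trans ex).
  by rewrite lee_fin lerDl.
have v0 x : 0 <= x -> vset g x 0.
  by move=> x0; exists x => //; exists 0%N, (fun=> x); split => //; rewrite big_ord0.
have ubd x : x < 1 -> has_ubound (vset g x) by move=> x1; exists V => s; exact: sV.
exists (fun x => sup (vset g x)), V; split => //; last first.
  move=> x x0 x1; rewrite ub_le_sup//=; [|exact: ubd|exact: v0].
  by apply: ge_sup; [exists 0; exact: v0|move=> s; exact: sV].
move=> x z x0 xz z1.
have [<-|xz'] := eqVneq x z; first by rewrite !subrr normr0.
have {}xz : x < z by rewrite lt_neqAle xz'.
have x1 : x < 1 by exact: lt_trans z1.
rewrite lerBrDr -lerBrDl; apply: ge_sup; first by exists 0; exact: v0.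
move=> s [e ex es]; rewrite lerBrDl addrC.
(* Chains increase strictly, so a chain ending before [x] is first prolonged to [x], while one
   ending at [x] goes straight to [z]. *)
have [eE|ex'] := eqVneq e x.
  apply: ub_le_sup; first exact: ubd.
  by exists z => //; apply: chain_ext => //; rewrite -eE.
apply: (@le_trans _ _ (s + `|g x - g e| + `|g z - g x|)); first by rewrite lerD2r lerDl.
apply: ub_le_sup; first exact: ubd.
exists z => //; apply: chain_ext => //; apply: chain_ext => //.
by rewrite lt_neqAle ex'.
Qed.

Variable M : nat.
Hypothesis M_gt0 : (0 < M)%N.
Implicit Types (G H : nat -> R -> R) (D : R).

Lemma controlled_cvar g : (cvar g < +oo)%E -> exists H D, 0 <= D /\
  controlled M (fun k u => g (pt M k u)) H D.
Proof.
move=> /variation_control[h [V [V0 gh hV]]].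
have mono k (u v : R) : u <= v -> pt M k u <= pt M k v.
  by move=> uv; rewrite ler_pM2r ?invr_gt0 ?ltr0n// lerD2l.
exists (fun k u => h (pt M k u)), (V *+ M); split; first by rewrite mulrn_wge0.
split.
  move=> k u v kM u0 uv v1.
  have /andP[? _] := ptI01 kM (introT andP (conj u0 (le_lt_trans uv v1))).
  have /andP[_ ?] := ptI01 kM (introT andP (conj (le_trans u0 uv) v1)).
  by apply: gh => //; exact: mono.
move=> u v uv; apply: (@le_trans _ _ (\sum_(k < M) V)); last by rewrite sumr_const card_ord.
apply: ler_sum => k _; have [u0 ukv v1] := uv _ (ltn_ord k).
have /andP[a1 a2] := ptI01 (ltn_ord k) (introT andP (conj u0 (le_lt_trans ukv v1))).
have /andP[b1 b2] := ptI01 (ltn_ord k) (introT andP (conj (le_trans u0 ukv) v1)).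
have /andP[c1 c2] := hV _ a1 a2; have /andP[d1 d2] := hV _ b1 b2.
lra.
Qed.

Lemma idx_off (x : R) : 0 <= x -> x < 1 -> (idx M x < M)%N /\ 0 <= off M x < 1.
Proof.
move=> x0 x1; have xI : I01 x by rewrite /I01/= x0.
have [k [u [kM u01 ->]]] := I01_pt M_gt0 xI.
by rewrite idx_pt// off_pt.
Qed.

Lemma assemble_bound G H D S x : controlled M G H D -> (forall k, (k < M)%N -> `|G k 0| <= S) ->
  0 <= x -> x < 1 -> `|assemble M G x| <= S + D.
Proof.
move=> GHD GS x0 x1; have [iM /andP[w0 w1]] := idx_off x0 x1.
rewrite /assemble -[G _ _](subrK (G (idx M x) 0)) addrC.
apply: le_trans (ler_normD _ _) _; apply: lerD; first exact: GS.
exact: controlled_osc GHD iM _ _ w1.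
Qed.

Lemma cvar_assemble G H D S : controlled M G H D -> 0 <= S -> 0 <= D ->
  (forall k, (k < M)%N -> `|G k 0| <= S) ->
  (cvar (assemble M G) <= ((6 * M%:R + 2) * (S + D))%:E)%E.
Proof.
move=> GHD S0 D0 GS.
(* [h] jumps by [W] from cell to cell. Between different cells the function changes by at most
   [2S + 2D], and the inner increment lost in the cell of [x] is at most [D], whence [2S + 3D]. *)
pose W := 2 * S + 3 * D.
pose h x := W * (idx M x)%:R + (H (idx M x) (off M x) - H (idx M x) 0).
have hH x : 0 <= x -> x < 1 -> 0 <= H (idx M x) (off M x) - H (idx M x) 0 <= D.
  move=> x0 x1; have [iM /andP[w0 w1]] := idx_off x0 x1.
  rewrite (controlled_incr GHD)// andbT.
  by case: GHD => GH _; exact: le_trans (GH _ _ _ iM (lexx 0) w0 w1).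
have W0 : 0 <= W by rewrite /W; lra.
have M0 : 0 <= M%:R :> R by [].
apply: (le_trans (@cvar_le _ h (W * M%:R + D) _ _ _)).
- move=> x y x0 xy y1; have x1 := lt_trans xy y1; have y0 := le_trans x0 (ltW xy).
  have [iM /andP[w0 w1]] := idx_off x0 x1; have [jM /andP[p0 p1]] := idx_off y0 y1.
  have ij : (idx M x <= idx M y)%N.
    by apply: le_truncn; rewrite ler_wpM2l// ltW.
  move: ij; rewrite leq_eqVlt => /orP[/eqP ij|ij].
    rewrite /h /assemble -ij.
    have op : off M x <= off M y by rewrite /off -ij lerD2r ler_wpM2l// ltW.
    by case: GHD => GH _; have := GH _ _ _ iM w0 op p1; lra.
  have bx := assemble_bound GHD GS x0 x1; have b_y := assemble_bound GHD GS y0 y1.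
  have /andP[h1 h2] := hH _ x0 x1; have /andP[h3 h4] := hH _ y0 y1.
  apply: (@le_trans _ _ (2 * S + 2 * D)).
    by apply: le_trans (ler_normB _ _) _; lra.
  have : W * (idx M x).+1%:R <= W * (idx M y)%:R by rewrite ler_wpM2l// ler_nat.
  rewrite -natr1 mulrDr mulr1 /h; rewrite /W in W0 *; lra.
- move=> x y x0 xy y1; have x1 := lt_trans xy y1; have y0 := le_trans x0 (ltW xy).
  have [jM _] := idx_off y0 y1.
  have /andP[h1 h2] := hH _ x0 x1; have /andP[h3 h4] := hH _ y0 y1.
  have : W * (idx M y)%:R <= W * M%:R by rewrite ler_wpM2l// ler_nat ltnW.
  have : 0 <= W * (idx M x)%:R by rewrite mulr_ge0.
  rewrite /h; lra.
- by rewrite addr_ge0// mulr_ge0.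
- rewrite lee_fin /W.
  have : 0 <= S * M%:R by rewrite mulr_ge0.
  have : 0 <= D * M%:R by rewrite mulr_ge0.
  lra.
Qed.

Lemma bvnorm_le f G H D S : ae_eq f (assemble M G) -> controlled M G H D -> 0 <= S -> 0 <= D ->
  (forall k, (k < M)%N -> `|G k 0| <= S) ->
  (bvnorm f <= ((6 * M%:R + 2) * (S + D))%:E)%E.
Proof.
move=> fG GHD S0 D0 GS; rewrite /bvnorm ge_max; apply/andP; split.
  apply: (@le_trans _ _ (S + D)%:E).
    apply: L1norm_le; first exact: addr_ge0.
    apply: negligibleS fG => x /= nf fx; apply: nf => xI.
    by rewrite fx//; case/andP: xI => x0 x1; exact: assemble_bound GHD _ x0 x1.
  have : 0 <= M%:R * (S + D) by rewrite mulr_ge0 ?addr_ge0.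
  by rewrite lee_fin; lra.
apply: le_trans (cvar_assemble GHD S0 D0 GS).
by apply: ereal_inf_lbound; exists (assemble M G).
Qed.

(** The L1 part is enough: on cell [k], of length [1/M], the function stays within [D] of its value
    at the left end. *)
Lemma bvnorm_ge f G H D k : ae_eq f (assemble M G) -> controlled M G H D -> (k < M)%N ->
  (((`|G k 0| - D) / M%:R)%:E <= bvnorm f)%E.
Proof.
move=> fG GHD kM; rewrite /bvnorm le_max; apply/orP; left.
have [neg|pos] := leP (`|G k 0| - D) 0.
  apply: le_trans (L1norm_ge0 _); rewrite lee_fin.
  by rewrite mulr_le0_ge0 ?invr_ge0.
have MR : M%:R != 0 :> R by rewrite pnatr_eq0 -lt0n.
have -> : M%:R^-1 = k.+1%:R / M%:R - k%:R / M%:R :> R by rewrite -natr1; field.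
apply: L1norm_ge.
- exact: ltW.
- by rewrite divr_ge0.
- by rewrite ltr_pM2r ?invr_gt0 ?ltr0n// ltr_nat.
- by rewrite ler_pdivrMr ?ltr0n// mul1r ler_nat.
apply: negligibleS fG => x /= nf fx; apply: nf => /andP[a b].
have x0 : 0 <= x by apply: le_trans (ltW a); rewrite divr_ge0.
have x1 : x < 1 by apply: (lt_le_trans b); rewrite ler_pdivrMr ?ltr0n// mul1r ler_nat.
have [iM /andP[w0 w1]] := idx_off x0 x1.
have ik : idx M x = k.
  by apply: truncn_def; rewrite mulrC -ler_pdivrMr ?ltr0n// -ltr_pdivlMr ?ltr0n// ltW.
rewrite fx ?/I01/= ?x0// /assemble ik lerBlDr.
have := controlled_osc GHD kM (lexx 0) w0 w1.
have := lerB_dist (G k 0) (G k (off M x)); rewrite distrC.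
lra.
Qed.

End BVBounds.

(** * Perturbed linear cocycles *)

Section Perturbation.
Variable R : realType.

Definition nrm (a b : nat) (X : 'M[R]_(a, b)) : R := \sum_i \sum_j `|X i j|.

Lemma nrm_ge0 a b (X : 'M[R]_(a, b)) : 0 <= nrm X.
Proof. by apply: sumr_ge0 => i _; exact: sumr_ge0. Qed.

Lemma nrm0 a b : nrm (0 : 'M[R]_(a, b)) = 0.
Proof. by rewrite /nrm big1// => i _; rewrite big1// => j _; rewrite mxE normr0. Qed.

Lemma nrm_entry a b (X : 'M[R]_(a, b)) i j : `|X i j| <= nrm X.
Proof.
rewrite /nrm (bigD1 i)//= (bigD1 j)//= -addrA lerDl addr_ge0 ?sumr_ge0// => k _.
exact: sumr_ge0.
Qed.

Lemma nrmD a b (X Y : 'M[R]_(a, b)) : nrm (X + Y) <= nrm X + nrm Y.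
Proof.
rewrite /nrm -big_split/=; apply: ler_sum => i _; rewrite -big_split/=.
by apply: ler_sum => j _; rewrite mxE; exact: ler_normD.
Qed.

Lemma nrmM a b c (X : 'M[R]_(a, b)) (Y : 'M[R]_(b, c)) : nrm (X *m Y) <= nrm X * nrm Y.
Proof.
rewrite /nrm mulr_suml; apply: ler_sum => i _; rewrite mulr_suml.
apply: (@le_trans _ _ (\sum_j \sum_k `|X i k| * `|Y k j|)).
  apply: ler_sum => j _; rewrite mxE; apply: le_trans (ler_norm_sum _ _ _) _.
  by apply: ler_sum => k _; rewrite normrM.
rewrite exchange_big/=; apply: ler_sum => k _; rewrite -mulr_sumr ler_wpM2l//.
by rewrite (bigD1 k)//= lerDl sumr_ge0// => l _; exact: sumr_ge0.
Qed.

Lemma geometric_near (c C r s : R) : 0 < c -> 0 < r -> 0 <= s -> s < r ->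
  \forall n \near \oo, C * s ^+ n <= c * r ^+ n.
Proof.
move=> c0 r0 s0 sr.
have q1 : `|s / r| < 1 by rewrite ger0_norm ?divr_ge0// ?ltW// ltr_pdivrMr// mul1r.
have H : C * (s / r) ^+ n @[n --> \oo] --> C * 0.
  by apply: cvgM; [exact: cvg_cst|exact: cvg_expr].
rewrite mulr0 in H; near=> n.
have : `|0 - C * (s / r) ^+ n| < c by near: n; move/cvgrPdist_lt: H; exact.
rewrite sub0r normrN => /ltW /(le_trans (ler_norm _)).
by rewrite expr_div_n mulrA ler_pdivrMr// exprn_gt0.
Unshelve. all: end_near. Qed.

(** After division by [rho^n] the increments are at most a geometric sequence of ratio
    [s = 1/(3 rho) < 1]. The intervals [[y n - K s^n, y n + K s^n]] are then nested, and [z] is the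
    supremum of their left ends. *)
Lemma perturbed_geometric (x e : nat -> R) (rho c : R) : 3^-1 < rho -> 0 <= c ->
  (forall n, x n.+1 = rho * x n + e n) -> (forall n, `|e n| <= c * 3^-1 ^+ n) ->
  exists z C, forall n, `|x n - rho ^+ n * z| <= C * 3^-1 ^+ n.
Proof.
move=> rho3 c0 xS eb.
have rho0 : 0 < rho by apply: lt_trans rho3; rewrite invr_gt0.
pose s := 3^-1 / rho.
have s0 : 0 < s by rewrite divr_gt0.
have s1 : s < 1 by rewrite ltr_pdivrMr// mul1r.
(* With this [K] the bound [(c / rho) s^n] on an increment equals [K s^n - K s^(n+1)]. *)
pose K := (c / rho) / (1 - s).
have K0 : 0 <= K by rewrite !divr_ge0// ?subr_ge0 ltW.
have KE : K * (1 - s) = c / rho by rewrite divfK// subr_eq0 gt_eqF.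
pose y n := x n / rho ^+ n.
have yS n : `|y n.+1 - y n| <= K * s ^+ n - K * s ^+ n.+1.
  have -> : y n.+1 - y n = e n / rho ^+ n.+1.
    by rewrite /y xS exprS; field; rewrite ?expf_neq0 gt_eqF.
  rewrite [s ^+ n.+1]exprS; have -> : K * s ^+ n - K * (s * s ^+ n) = (c * 3^-1 ^+ n) / rho ^+ n.+1.
    transitivity ((K * (1 - s)) * s ^+ n); first by ring.
    by rewrite KE /s expr_div_n exprS; field; rewrite ?expf_neq0 ?gt_eqF.
  have i0 : 0 <= (rho ^+ n.+1)^-1 by rewrite invr_ge0 exprn_ge0// ltW.
  by rewrite normrM (ger0_norm i0) ler_wpM2r.
have bS m n : (m <= n)%N -> y m - K * s ^+ m <= y n - K * s ^+ n.
  elim: n => [|n IH]; first by rewrite leqn0 => /eqP->.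
  rewrite leq_eqVlt => /orP[/eqP->//|]; rewrite ltnS => /IH{IH} h.
  by apply: (le_trans h); have := yS n; rewrite ler_norml => /andP[]; lra.
have aS m n : (m <= n)%N -> y n + K * s ^+ n <= y m + K * s ^+ m.
  elim: n => [|n IH]; first by rewrite leqn0 => /eqP->.
  rewrite leq_eqVlt => /orP[/eqP->//|]; rewrite ltnS => /IH{IH} h.
  by apply: le_trans h; have := yS n; rewrite ler_norml => /andP[]; lra.
have ba m n : y m - K * s ^+ m <= y n + K * s ^+ n.
  have h1 := bS m _ (leq_maxl m n); have h2 := aS n _ (leq_maxr m n).
  have h3 : 0 <= K * s ^+ maxn m n by rewrite mulr_ge0// exprn_ge0// ltW.
  lra.
pose z := sup (range (fun n => y n - K * s ^+ n)).
exists z, K => n.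
have z1 : y n - K * s ^+ n <= z.
  by apply: ub_le_sup; [exists (y 0%N + K * s ^+ 0) => _ [m _ <-]; exact: ba|exists n].
have z2 : z <= y n + K * s ^+ n.
  by apply: ge_sup; [exists (y 0%N - K * s ^+ 0); exists 0%N|move=> _ [m _ <-]; exact: ba].
have r0 : 0 < rho ^+ n by rewrite exprn_gt0.
have -> : x n - rho ^+ n * z = rho ^+ n * (y n - z).
  by rewrite mulrBr /y mulrCA mulfV ?mulr1// gt_eqF.
have -> : 3^-1 ^+ n = rho ^+ n * s ^+ n :> R.
  by rewrite /s expr_div_n mulrCA mulfV ?mulr1// gt_eqF.
rewrite normrM gtr0_norm// mulrCA ler_pM2l// ler_norml; apply/andP; split; lra.
Qed.

End Perturbation.

(** * Perturbed cocycles with diagonal dual coordinates *)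

Section CocycleAsymptotics.
Variables (R : realType) (M m : nat).
Variables (A : nat -> 'M[R]_M) (Psi : nat -> 'M[R]_(M, m)) (V : nat -> 'M[R]_(m, M)).
Variables (delta : 'I_m -> R) (w : nat -> nat) (B : R).

Definition dpow n : 'M[R]_m := diag_mx (\row_j delta j ^+ n).

Fixpoint wprod n k : 'M[R]_M :=
  match k with 0%N => 1%:M | k'.+1 => wprod n k' *m A (w (n + k')) end.

Hypothesis delta_gt : forall j, 3^-1 < delta j.
Hypothesis delta_mono : forall i j : 'I_m, (i <= j)%N -> delta j <= delta i.
Hypothesis APsi : forall n, A (w n) *m Psi (w n.+1) = Psi (w n) *m dpow 1.
Hypothesis A6 : forall n, wprod n 6 = Psi (w n) *m dpow 6 *m V (w n).
Hypothesis B_ge : forall n, [/\ nrm (A (w n)) <= B, nrm (Psi (w n)) <= B & nrm (V (w n)) <= B].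
Hypothesis B_gt0 : 0 < B.

Variables (q e : nat -> 'rV[R]_M) (c : R).
Hypothesis c_ge0 : 0 <= c.
Hypothesis qS : forall n, q n.+1 = q n *m A (w n) + e n.
Hypothesis eb : forall n, nrm (e n) <= c * 3^-1 ^+ n.

Let X n := q n *m Psi (w n).

Lemma coord_limit : exists (z : 'I_m -> R) (C : R), 0 <= C /\
  forall n j, `|X n 0 j - delta j ^+ n * z j| <= C * 3^-1 ^+ n.
Proof.
have H j : exists zC : R * R, forall n, `|X n 0 j - delta j ^+ n * zC.1| <= zC.2 * 3^-1 ^+ n.
  have [] := @perturbed_geometric R (fun n => X n 0 j)
    (fun n => (e n *m Psi (w n.+1)) 0 j) (delta j) (c * B).
  - exact: delta_gt.
  - by rewrite mulr_ge0// ltW.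
  - move=> n; rewrite /X qS mulmxDl -mulmxA APsi mulmxA mxE; congr (_ + _).
    by rewrite mul_mx_diag !mxE expr1 mulrC.
  - move=> n; apply: le_trans (nrm_entry _ _ _) _; apply: le_trans (nrmM _ _) _.
    rewrite mulrAC; apply: ler_pM; rewrite ?nrm_ge0//.
    by have [] := B_ge n.+1.
  by move=> z [C h]; exists (z, C).
have [zC zCP] := choice H.
exists (fun j => (zC j).1), (\sum_j `|(zC j).2|); split; first exact: sumr_ge0.
move=> n j; apply: le_trans (zCP j n) _; rewrite ler_wpM2r ?exprn_ge0 ?invr_ge0//.
by apply: le_trans (ler_norm _) _; rewrite (bigD1 j)//= lerDl sumr_ge0.
Qed.

Lemma word_step k : exists C, 0 <= C /\
  forall n, nrm (q (n + k)%N - q n *m wprod n k) <= C * 3^-1 ^+ n.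
Proof.
elim: k => [|k [C [C0 IH]]].
  by exists 0; split => // n; rewrite addn0 mulmx1 subrr nrm0 mul0r.
exists (C * B + c); split; first by rewrite addr_ge0// mulr_ge0// ltW.
move=> n; rewrite addnS qS /= mulmxA -addrA [e _ - _]addrC addrA -mulmxBl.
apply: le_trans (nrmD _ _) _; rewrite mulrDl; apply: lerD.
  apply: le_trans (nrmM _ _) _; rewrite mulrAC; apply: ler_pM; rewrite ?nrm_ge0//.
  by have [] := B_ge (n + k)%N.
apply: le_trans (eb _) _; rewrite ler_wpM2l// exprD ler_piMr ?exprn_ge0 ?invr_ge0//.
by rewrite exprn_ile1 ?invr_ge0// invf_le1// ler1n.
Qed.

(** The coordinates [X n] miss part of [q n], but by [A6] the product of six steps factors through
    them, so the missed part disappears up to the accumulated errors. *)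
Lemma q_bound : exists C, 0 <= C /\ forall n, nrm (q (n + 6)%N) <= C * (nrm (X n) + 3^-1 ^+ n).
Proof.
have [C [C0 H]] := word_step 6.
exists (nrm (dpow 6) * B + C); split; first by rewrite addr_ge0// mulr_ge0 ?nrm_ge0// ltW.
move=> n; rewrite -[q _](subrK (q n *m wprod n 6)) addrC.
have t0 : 0 <= 3^-1 ^+ n :> R by rewrite exprn_ge0 ?invr_ge0.
apply: le_trans (nrmD _ _) _; rewrite A6 !mulmxA -/(X n) in H *.
have h1 := H n; rewrite A6 !mulmxA -/(X n) in h1.
have [_ _ VB] := B_ge n.
have h2 : nrm (X n *m dpow 6 *m V (w n)) <= nrm (X n) * nrm (dpow 6) * B.
  apply: le_trans (nrmM _ _) _; apply: ler_pM; rewrite ?nrm_ge0//; exact: nrmM.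
have x0 := nrm_ge0 (X n); have d0 := nrm_ge0 (dpow 6).
have h3 : 0 <= nrm (dpow 6) * B * 3^-1 ^+ n by rewrite !mulr_ge0// ltW.
have h4 : 0 <= C * nrm (X n) by rewrite mulr_ge0.
rewrite mulrDl !mulrDr; lra.
Qed.

Variables (b : nat -> R) (K : R).
Hypothesis K_gt0 : 0 < K.
Hypothesis b_le : forall n, b n <= K * (nrm (q n) + 3^-1 ^+ n).
Hypothesis b_ge : forall n, nrm (q n) <= K * (b n + 3^-1 ^+ n).

Lemma growth_leading (z : 'I_m -> R) (C : R) (j : 'I_m) : 0 <= C ->
  (forall n i, `|X n 0 i - delta i ^+ n * z i| <= C * 3^-1 ^+ n) ->
  z j != 0 -> (forall i : 'I_m, (i < j)%N -> z i = 0) ->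
  exists c1 c2, [/\ 0 < c1, 0 < c2 &
    \forall n \near \oo, c1 * delta j ^+ n <= b n <= c2 * delta j ^+ n].
Proof.
move=> C0 HX zj zi.
have i3 : 0 < 3^-1 :> R by rewrite invr_gt0.
have dj0 : 0 < delta j by exact: lt_trans (delta_gt j).
have d3 n : 3^-1 ^+ n <= delta j ^+ n by rewrite lerXn2r ?nnegrE ?ltW.
have [Cq [Cq0 Hq]] := q_bound.
have XS n : nrm (X n) <= (\sum_i `|z i| + C *+ m) * delta j ^+ n.
  rewrite /nrm big_ord1 mulrDl mulr_suml -[X in C *+ X]card_ord -sumr_const mulr_suml -big_split/=.
  apply: ler_sum => i _.
  have -> : X n 0 i = delta i ^+ n * z i + (X n 0 i - delta i ^+ n * z i) by ring.
  apply: le_trans (ler_normD _ _) _; apply: lerD.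
    rewrite normrM mulrC; have [ij|ij] := ltnP i j; first by rewrite zi// normr0 !mul0r.
    have di0 : 0 <= delta i by rewrite ltW// (lt_trans i3).
    by rewrite ler_wpM2l// ger0_norm ?exprn_ge0// lerXn2r ?nnegrE ?delta_mono// ltW.
  by apply: le_trans (HX n i) _; rewrite ler_wpM2l.
(* Half of the constant [|z j| / (B K)] that the leading mode supplies; the other half absorbs the
   terms of order [3^-n]. *)
pose c1 := `|z j| / (2 * (B * K)).
pose E := \sum_i `|z i| + C *+ m.
have E0 : 0 <= E by rewrite addr_ge0 ?sumr_ge0// mulrn_wge0.
(* The upper bound at time [n] comes from the coordinates at time [n - 6], hence the sixth power. *)
pose c2 := K * (Cq * (E + 1) + 1) / delta j ^+ 6.
have c20 : 0 < c2.
  by rewrite divr_gt0 ?exprn_gt0// mulr_gt0// ltr_wpDl// mulr_ge0// addr_ge0.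
have c10 : 0 < c1 by rewrite divr_gt0 ?normr_gt0// !mulr_gt0.
exists c1, c2; split => //.
near=> n; apply/andP; split.
  have h1 : `|z j| * delta j ^+ n - C * 3^-1 ^+ n <= `|X n 0 j|.
    have := HX n j; rewrite distrC => h; have := lerB_dist (delta j ^+ n * z j) (X n 0 j).
    have dn : 0 <= delta j ^+ n by rewrite exprn_ge0// ltW.
    by rewrite normrM (ger0_norm dn) [`|z j| * _]mulrC; lra.
  have h2 : `|X n 0 j| <= K * (b n + 3^-1 ^+ n) * B.
    apply: le_trans (nrm_entry _ _ _) _; apply: le_trans (nrmM _ _) _.
    by have [_ PB _] := B_ge n; apply: ler_pM; rewrite ?nrm_ge0.
  have h3 : (C / (B * K) + 1) * 3^-1 ^+ n <= c1 * delta j ^+ n.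
    by near: n; apply: geometric_near => //; exact: ltW.
  have BK : 0 < B * K by rewrite mulr_gt0.
  have zE : `|z j| = 2 * c1 * (B * K) by rewrite /c1; field; rewrite !gt_eqF.
  have CE : C = C / (B * K) * (B * K) by rewrite divfK// gt_eqF.
  have : (2 * c1 * delta j ^+ n - C / (B * K) * 3^-1 ^+ n) * (B * K) <= (b n + 3^-1 ^+ n) * (B * K).
    move: h1; rewrite zE {1}CE => h1; apply: le_trans (_ : K * (b n + 3^-1 ^+ n) * B <= _).
      by apply: le_trans h2; apply: le_trans h1; rewrite le_eqVlt; apply/orP; left; apply/eqP; ring.
    by rewrite le_eqVlt; apply/orP; left; apply/eqP; ring.
  by rewrite ler_pM2r//; lra.
have n6 : (6 <= n)%N by near: n; exact: nbhs_infty_ge.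
have := b_le n; have := Hq (n - 6)%N; rewrite subnK// => h1 h2.
have h3 := XS (n - 6)%N; have h4 := d3 (n - 6)%N.
have h5 : 3^-1 ^+ n <= delta j ^+ (n - 6).
  by apply: le_trans h4; rewrite ler_wiXn2l ?leq_subr// ?ltW// invf_lt1// ltr1n.
have -> : c2 * delta j ^+ n = K * (Cq * (E + 1) + 1) * delta j ^+ (n - 6).
  by rewrite -[X in delta j ^+ X](subnK n6) exprD /c2; field; rewrite gt_eqF.
apply: (le_trans h2); rewrite -mulrA ler_pM2l// mulrDl mul1r; apply: lerD => //.
apply: (le_trans h1); rewrite -mulrA ler_wpM2l// mulrDl mul1r; exact: lerD.
Unshelve. all: end_near. Qed.

Lemma growth_trailing (z : 'I_m -> R) (C : R) : 0 <= C ->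
  (forall n i, `|X n 0 i - delta i ^+ n * z i| <= C * 3^-1 ^+ n) ->
  (forall i, z i = 0) ->
  exists c2, 0 < c2 /\ \forall n \near \oo, b n <= c2 * 3^-1 ^+ n.
Proof.
move=> C0 HX zi.
have i3 : 0 < 3^-1 :> R by rewrite invr_gt0.
have [Cq [Cq0 Hq]] := q_bound.
have XS n : nrm (X n) <= (C *+ m) * 3^-1 ^+ n.
  rewrite /nrm big_ord1 -[X in C *+ X]card_ord -sumr_const mulr_suml.
  by apply: ler_sum => i _; have := HX n i; rewrite zi mulr0 subr0.
pose E := C *+ m.
have E0 : 0 <= E by rewrite mulrn_wge0.
pose c2 := K * (Cq * (E + 1) + 1) / 3^-1 ^+ 6.
exists c2; split.
  by rewrite divr_gt0 ?exprn_gt0// mulr_gt0// ltr_wpDl// mulr_ge0// addr_ge0.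
near=> n.
have n6 : (6 <= n)%N by near: n; exact: nbhs_infty_ge.
have := b_le n; have := Hq (n - 6)%N; rewrite subnK// => h1 h2.
have h3 := XS (n - 6)%N.
have h5 : 3^-1 ^+ n <= 3^-1 ^+ (n - 6) :> R.
  by rewrite ler_wiXn2l ?leq_subr// ?ltW// invf_lt1// ltr1n.
have -> : c2 * 3^-1 ^+ n = K * (Cq * (E + 1) + 1) * 3^-1 ^+ (n - 6).
  have aux (t Y : R) : 0 < t -> Y / t ^+ 6 * t ^+ n = Y * t ^+ (n - 6).
    by move=> t0; rewrite -[X in _ * t ^+ X](subnK n6) exprD; field; rewrite gt_eqF.
  exact: aux.
apply: (le_trans h2); rewrite -mulrA ler_pM2l// mulrDl mul1r; apply: lerD => //.
apply: (le_trans h1); rewrite -mulrA ler_wpM2l// mulrDl mul1r; exact: lerD.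
Unshelve. all: end_near. Qed.

End CocycleAsymptotics.

(** * Lyapunov exponents of the Perron-Frobenius cocycle *)

Section StepFunctions.
Variables (R : realType) (M : nat).
Hypothesis M_gt0 : (0 < M)%N.
Local Notation mu := (@lebesgue_measure R).

Definition breaks (k : nat) : R := k%:R / M%:R.

Definition cells (v : 'rV[R]_M) (k : nat) (_ : R) : R :=
  if insub k is Some i then v 0 i else 0.

Lemma cellsE v (i : 'I_M) u : cells v i u = v 0 i.
Proof. by rewrite /cells valK. Qed.

(** The bound 0 means that for step functions the error terms of the recursion vanish
    identically. *)
Lemma cells_controlled v : controlled M (cells v) (fun _ _ => 0) 0.
Proof.
split=> [k u w _ _ _ _|u w _]; first by rewrite /cells !subrr normr0.
by rewrite big1// => k _; rewrite subrr.
Qed.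

Lemma vecfun_ae (v : 'rV[R]_M) : ae_eq (vecfun breaks v) (assemble M (cells v)).
Proof.
apply: negligibleS (ae_off_gt0 R M) => x /= nf xb; apply: nf => xI.
have [k [u [kM u01 xE]]] := I01_pt M_gt0 xI.
have u0 : 0 < u < 1.
  move: u01 => /andP[u0 ->]; rewrite andbT lt_neqAle u0 andbT.
  by apply: contraNneq (xb k) => e; rewrite xE -e.
have MR : 0 < M%:R :> R by rewrite ltr0n.
rewrite xE assemble_pt// /vecfun -[k]/(nat_of_ord (Ordinal kM)) cellsE.
rewrite (bigD1 (Ordinal kM))//= /breaks /pt !ltr_pM2r ?invr_gt0//.
move: (u0) => /andP[u1 u2].
rewrite ltrDl u1 -natr1 ltrD2l u2 mulr1 big1 ?addr0// => i ik.
rewrite !ltr_pM2r ?invr_gt0//; case: ifPn => [/andP[h1 h2]|]; last by rewrite mulr0.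
exfalso; move/eqP: ik; apply; apply/val_inj => /=; apply/eqP; rewrite eqn_leq.
have ik : (i < k.+1)%N by rewrite -(ltr_nat R) -natr1; lra.
have ki : (k < i.+1)%N by rewrite -(ltr_nat R); lra.
by rewrite -ltnS ik -ltnS ki.
Qed.

Lemma vecfun_inBV (v : 'rV[R]_M) : inBV (vecfun breaks v).
Proof.
have vS k : (k < M)%N -> `|cells v k 0| <= nrm v.
  by move=> kM; rewrite -[k]/(nat_of_ord (Ordinal kM)) cellsE; exact: nrm_entry.
split.
- apply: measurable_funTS; apply: measurable_sum => k; apply: measurable_funM => //.
  rewrite (_ : (fun _ => _) = \1_(`]breaks k, breaks k.+1[%classic : set R)).
    exact: measurable_indic.
  apply/funext => x; rewrite indicE; case: ifPn => h.
    by rewrite mem_set//= in_itv.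
  by rewrite memNset//= in_itv; exact/negP.
- exists (nrm v + 0); apply: negligibleS (vecfun_ae v) => x /= nf fx; apply: nf => xI.
  rewrite fx//; case/andP: xI => x0 x1.
  exact: (assemble_bound M_gt0 (cells_controlled v) vS x0 x1).
- have := cvar_assemble M_gt0 (cells_controlled v) (nrm_ge0 v) (lexx 0) vS.
  move=> /le_lt_trans; move=> /(_ +oo%E (ltry _)); apply: le_lt_trans.
  apply: ereal_inf_lbound; exists (assemble M (cells v)) => //.
  exact: vecfun_ae.
Qed.

Variable t : nat -> nat.
Hypothesis t_lt : forall p, (p < 3 * M)%N -> (t p < M)%N.

Definition tmat : 'M[R]_M :=
  \matrix_(j, k) (3^-1 * \sum_(p < 3 * M | t p == k) (p %/ 3 == j)%N%:R).

Lemma mulmx_tmat (v : 'rV[R]_M) (k : 'I_M) :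
  (v *m tmat) 0 k = 3^-1 * \sum_(p < 3 * M | t p == k) cells v (p %/ 3)%N 0.
Proof.
rewrite mxE; under eq_bigr do rewrite mxE mulrCA mulr_sumr.
rewrite -mulr_sumr exchange_big/=; congr (_ * _); apply: eq_bigr => p _.
have pM : (p %/ 3 < M)%N by rewrite ltn_divLR// [(M * 3)%N]mulnC.
rewrite -[(p %/ 3)%N]/(nat_of_ord (Ordinal pM)) cellsE (bigD1 (Ordinal pM))//= eqxx mulr1.
rewrite big1 ?addr0// => i ip; case: eqP => [e|_]; last by rewrite mulr0.
by case/eqP: ip; apply/val_inj.
Qed.

Lemma Lop_cells (v : 'rV[R]_M) k u : (k < M)%N -> Lop M t (cells v) k u = cells (v *m tmat) k u.
Proof.
move=> kM; rewrite -[k]/(nat_of_ord (Ordinal kM)) cellsE mulmx_tmat.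
by congr (_ * _); apply: eq_bigr.
Qed.

Lemma tmat_represents : represents (bmap M t) (bdata R M t) breaks tmat.
Proof.
move=> v; have H := pfop_ae t M_gt0 (vecfun_ae v).
apply: ae_mono2 H (vecfun_ae (v *m tmat)) => x h1 h2 xI.
rewrite h1// h2//; move: xI => /andP[x0 x1]; have [iM _] := idx_off M_gt0 x0 x1.
exact: Lop_cells.
Qed.

End StepFunctions.

(** * From BV norms to sampled values *)

Section System.
Variables (R : realType) (M : nat) (t : nat -> nat -> nat).
Hypothesis M_gt0 : (0 < M)%N.
Local Notation mu := (@lebesgue_measure R).

Let T i := @bmap R M (t i).
Let d i := bdata R M (t i).
Let A i : 'M[R]_M := tmat R M (t i).

Variable w : int -> nat.
Hypothesis t_lt : forall n : nat, forall p, (p < 3 * M)%N -> (t (w n%:Z) p < M)%N.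

Fixpoint Gseq (G : nat -> R -> R) (n : nat) : nat -> R -> R :=
  match n with 0%N => G | n'.+1 => Lop M (t (w n'%:Z)) (Gseq G n') end.

Definition samples (G : nat -> R -> R) : 'rV[R]_M := \row_k G k 0.

Lemma PFn_ae f G n : ae_eq f (assemble M G) -> ae_eq (PFn T d w n f) (assemble M (Gseq G n)).
Proof. by move=> fG; elim: n => //= n IH; exact: (pfop_ae (t (w n%:Z)) M_gt0 IH). Qed.

Lemma Gseq_controlled G H D n : controlled M G H D ->
  controlled M (Gseq G n) (Gseq H n) (D * 3^-1 ^+ n).
Proof.
move=> GHD; elim: n => [|n IH] /=; first by rewrite expr0 mulr1.
by rewrite exprSr mulrA; exact: (controlled_Lop (t_lt n) IH).
Qed.

(** [Lop] reads the function at the points 0, 1/3 and 2/3 of the cells, the matrix only at the left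
    ends. Each of the [3M] pieces contributes a third of an oscillation inside a cell, at most
    [D 3^-n]. *)
Lemma samples_step G H D n : controlled M G H D -> 0 <= D ->
  nrm (samples (Gseq G n.+1) - samples (Gseq G n) *m A (w n%:Z)) <= (M%:R * D) * 3^-1 ^+ n.
Proof.
move=> /Gseq_controlled - /(_ n) GHD D0; set Dn := D * _ in GHD.
have Dn0 : 0 <= Dn by rewrite mulr_ge0// exprn_ge0// invr_ge0.
rewrite -mulrA -/Dn /nrm big_ord1.
apply: (@le_trans _ _ (\sum_(k < M) 3^-1 * \sum_(p < 3 * M | t (w n%:Z) p == k) Dn)).
  apply: ler_sum => k _; rewrite !mxE /= -/(A _).
  have -> : \sum_j samples (Gseq G n) 0 j * A (w n%:Z) j k = (samples (Gseq G n) *m A (w n%:Z)) 0 k.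
    by rewrite mxE.
  rewrite /A mulmx_tmat// /Lop -mulrBr -sumrB normrM ger0_norm ?invr_ge0//.
  rewrite ler_wpM2l ?invr_ge0//; apply: le_trans (ler_norm_sum _ _ _) _; apply: ler_sum => p _.
  have pM : (p %/ 3 < M)%N by rewrite ltn_divLR// [(M * 3)%N]mulnC.
  rewrite -[X in cells _ X]/(nat_of_ord (Ordinal pM)) cellsE mxE/=.
  have /andP[h1 h2] : 0 <= ((p %% 3)%:R + (0 : R)) / 3 < 1 by apply: refine01; rewrite lexx ltr01.
  exact: controlled_osc GHD pM _ h1 h2.
rewrite -mulr_sumr (exchange_big_dep xpredT)//=.
under eq_bigr => p _ do rewrite (big_pred1 (Ordinal (t_lt n (ltn_ord p))))//=.
rewrite sumr_const card_ord. by rewrite -[Dn *+ _]mulr_natl natrM !mulrA mulVf ?mul1r.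
Qed.

Variables (m : nat) (Psi : nat -> 'M[R]_(M, m)) (V : nat -> 'M[R]_(m, M)).
Variables (delta : 'I_m -> R) (B : R).
Let wn (n : nat) : nat := w n%:Z.
Hypothesis delta_gt : forall j, 3^-1 < delta j.
Hypothesis delta_mono : forall i j : 'I_m, (i <= j)%N -> delta j <= delta i.
Hypothesis APsi : forall n, A (wn n) *m Psi (wn n.+1) = Psi (wn n) *m dpow delta 1.
Hypothesis VPsi : forall n, V (wn n) *m Psi (wn n) = 1%:M.
Hypothesis A6 : forall n, wprod A wn n 6 = Psi (wn n) *m dpow delta 6 *m V (wn n).
Hypothesis B_ge : forall n, [/\ nrm (A (wn n)) <= B, nrm (Psi (wn n)) <= B & nrm (V (wn n)) <= B].
Hypothesis B_gt0 : 0 < B.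

Let pnorm f n := bvnorm (PFn T d w n f).

Lemma pnorm_ge0 f n : (0 <= pnorm f n)%E.
Proof. by rewrite /pnorm /bvnorm le_max L1norm_ge0. Qed.

(** The variation inside the cells has shrunk to [D 3^-n], so up to this slack the BV norm and the
    finite vector of samples control each other, with one constant for both directions. *)
Lemma pnorm_comparison f G H D : ae_eq f (assemble M G) -> controlled M G H D -> 0 <= D ->
  exists K, [/\ 0 < K, forall n, pnorm f n = (fine (pnorm f n))%:E,
    forall n, fine (pnorm f n) <= K * (nrm (samples (Gseq G n)) + 3^-1 ^+ n) &
    forall n, nrm (samples (Gseq G n)) <= K * (fine (pnorm f n) + 3^-1 ^+ n)].
Proof.
move=> fG GHD D0.
have MR : 0 < M%:R :> R by rewrite ltr0n.
have t0 n : 0 <= 3^-1 ^+ n :> R by rewrite exprn_ge0// invr_ge0.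
have up n : (pnorm f n <= ((6 * M%:R + 2) * (nrm (samples (Gseq G n)) + D * 3^-1 ^+ n))%:E)%E.
  apply: (bvnorm_le M_gt0 (PFn_ae n fG) (Gseq_controlled n GHD)).
  - exact: nrm_ge0.
  - exact: mulr_ge0.
  - move=> k kM; have := nrm_entry (samples (Gseq G n)) 0 (Ordinal kM).
    by rewrite mxE.
have finE n : pnorm f n = (fine (pnorm f n))%:E.
  rewrite fineK// ge0_fin_numE ?pnorm_ge0//; exact: le_lt_trans (up n) (ltry _).
have b0 n : 0 <= fine (pnorm f n) by rewrite fine_ge0// pnorm_ge0.
pose K1 := (6 * M%:R + 2) * (1 + D); pose K2 := M%:R * M%:R + M%:R * D.
have K10 : 0 < K1 by rewrite mulr_gt0//; lra.
have K20 : 0 < K2 by rewrite ltr_pwDl ?mulr_gt0// mulr_ge0// ltW.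
exists (K1 + K2); split => // [|n|n]; first exact: addr_gt0.
  have := up n; rewrite finE lee_fin => /le_trans; apply.
  have q0 := nrm_ge0 (samples (Gseq G n)); have t0n := t0 n.
  apply: (@le_trans _ _ (K1 * (nrm (samples (Gseq G n)) + 3^-1 ^+ n))).
    rewrite /K1 -mulrA ler_pM2l; last lra.
    have h1 : 0 <= D * nrm (samples (Gseq G n)) by rewrite mulr_ge0.
    by rewrite mulrDl mul1r mulrDr; lra.
  by rewrite ler_wpM2r ?addr_ge0// lerDl ltW.
have lo k : (k < M)%N -> `|Gseq G n k 0| <= M%:R * fine (pnorm f n) + D * 3^-1 ^+ n.
  move=> kM; have := bvnorm_ge M_gt0 (PFn_ae n fG) (Gseq_controlled n GHD) kM.
  rewrite -/(pnorm f n) finE lee_fin ler_pdivrMr//.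
  by rewrite [fine _ * _]mulrC; lra.
apply: (@le_trans _ _ (K2 * (fine (pnorm f n) + 3^-1 ^+ n))).
  apply: (@le_trans _ _ (\sum_(k < M) (M%:R * fine (pnorm f n) + D * 3^-1 ^+ n))).
    by rewrite /nrm big_ord1; apply: ler_sum => k _; rewrite mxE; exact: lo.
  rewrite sumr_const card_ord -[_ *+ M]mulr_natl /K2.
  have h1 : 0 <= M%:R * D * fine (pnorm f n) by rewrite !mulr_ge0// ltW.
  have h2 : 0 <= M%:R * M%:R * 3^-1 ^+ n :> R by rewrite !mulr_ge0// ltW.
  by rewrite mulrDr mulrDl !mulrDr !mulrA; lra.
by rewrite ler_wpM2r ?addr_ge0// lerDr ltW.
Qed.

Lemma lyap_alternative f : inBV f ->
  (exists j, lyap T d w f = (ln (delta j))%:E) \/ (lyap T d w f <= (ln 3^-1)%:E)%E.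
Proof.
(* [evar f] is an infimum over representatives; being finite, it provides one of finite
   variation. *)
move=> [_ _ /ereal_inf_lt[_ [g fg <-] gfin]].
have [H [D [D0 GHD]]] := controlled_cvar M_gt0 gfin.
have {}fg : ae_eq f (assemble M (fun k u => g (pt M k u))).
  apply: negligibleS fg => x /= nf fx; apply: nf => xI; rewrite fx//.
  by have [k [u [kM u01 ->]]] := I01_pt M_gt0 xI; rewrite assemble_pt.
have [K [K0 finE bU bL]] := pnorm_comparison fg GHD D0.
set G := fun k u => g _ in fg GHD bU bL.
pose q n := samples (Gseq G n); pose e n := q n.+1 - q n *m A (wn n).
have qS n : q n.+1 = q n *m A (wn n) + e n by rewrite /e subrKC.
have c0 : 0 <= M%:R * D by rewrite mulr_ge0.
have eb n : nrm (e n) <= M%:R * D * 3^-1 ^+ n by exact: samples_step GHD D0.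
have [z [C [C0 zP]]] := coord_limit delta_gt APsi B_ge B_gt0 c0 qS eb.
have [zz|/existsNP[j0 /eqP zj0]] := pselect (forall i, z i = 0).
  right; have [c2 [c20 h]] := growth_trailing A6 B_ge B_gt0 c0 qS eb K0 bU C0 zP zz.
  apply: (growth_rate_le c20); first by rewrite invr_gt0.
  apply: filterS h => n h; rewrite -/(pnorm f n) pnorm_ge0/= finE lee_fin//.
(* The rates decrease with the index, so the first nonzero limit belongs to the dominant mode. *)
left; pose j := [arg min_(i < j0 | z i != 0) (i : nat)].
have [zj jmin] : z j != 0 /\ (forall i : 'I_m, (i < j)%N -> z i = 0).
  rewrite /j; case: arg_minnP => // i zi imin; split => // i' i'i.
  by apply: contraTeq i'i => /imin; rewrite -leqNgt.
exists j; have [c1 [c2 [c10 c20 h]]] :=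
  growth_leading delta_gt delta_mono A6 B_ge B_gt0 c0 qS eb K0 bU bL C0 zP zj jmin.
have dj : 0 < delta j by apply: lt_trans (delta_gt j); rewrite invr_gt0.
apply: (cvg_limn_einf_sup _).2; apply: (growth_rate c10 c20 dj).
by apply: filterS h => n h; rewrite -/(pnorm f n) finE !lee_fin.
Qed.

(** For this step function there are no errors, and by duality of [V] and [Psi] its coordinate
    vector is exactly [delta j ^+ n] times the [j]-th unit vector: every rate is attained. *)
Lemma lyap_eigenfunction j : lyap T d w (vecfun (breaks R M) (row j (V (wn 0)))) = (ln (delta j))%:E.
Proof.
set v := row j _.
have fG := vecfun_ae M_gt0 v; have GHD := cells_controlled v.
have [K [K0 finE bU bL]] := pnorm_comparison fG GHD (lexx 0).
set G := cells v in fG GHD bU bL; set f := vecfun _ _ in fG finE bU bL *.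
pose q n := samples (Gseq G n); pose e n := q n.+1 - q n *m A (wn n).
have qS n : q n.+1 = q n *m A (wn n) + e n by rewrite /e subrKC.
have eb n : nrm (e n) <= 0 * 3^-1 ^+ n by have := samples_step n GHD (lexx 0); rewrite mulr0.
have e0 n : e n = 0.
  apply/matrixP => i k; rewrite [RHS]mxE; apply/eqP; rewrite -normr_le0.
  by apply: le_trans (nrm_entry _ _ _) _; have := eb n; rewrite mul0r.
have XE n : q n *m Psi (wn n) = delta j ^+ n *: delta_mx 0 j.
  elim: n => [|n IH].
    rewrite expr0 scale1r; have -> : q 0%N = v.
      by apply/rowP => k; rewrite mxE /= /G cellsE.
    by rewrite /v -row_mul VPsi row1.
  rewrite qS e0 addr0 -mulmxA APsi mulmxA IH -scalemxAl exprSr.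
  apply/rowP => k; rewrite mul_mx_diag !mxE expr1 eqxx/=; case: eqVneq => [->|_] /=.
    by rewrite mul1r mulr1.
  by rewrite mul0r !mulr0.
pose z i : R := (i == j)%:R.
have zP n i : `|(q n *m Psi (wn n)) 0 i - delta i ^+ n * z i| <= 0 * 3^-1 ^+ n.
  rewrite XE !mxE /z mul0r /=; case: eqVneq => [->|_]; first by rewrite subrr normr0.
  by rewrite !mulr0 subrr normr0.
have [c1 [c2 [c10 c20 h]]] : exists c1 c2, [/\ 0 < c1, 0 < c2 &
    \forall n \near \oo, c1 * delta j ^+ n <= fine (pnorm f n) <= c2 * delta j ^+ n].
  apply: (growth_leading delta_gt delta_mono A6 B_ge B_gt0 (lexx 0) qS eb K0 bU bL (lexx 0) zP).
    by rewrite /z eqxx oner_eq0.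
  by move=> i ij; rewrite /z; case: eqVneq ij => // ->; rewrite ltnn.
have dj : 0 < delta j by apply: lt_trans (delta_gt j); rewrite invr_gt0.
apply: (cvg_limn_einf_sup _).2; apply: (growth_rate c10 c20 dj).
by apply: filterS h => n h; rewrite -/(pnorm f n) finE !lee_fin.
Qed.

(** The exponents not given by some [delta j] lie at or below the essential bound, and every
    [delta j] lies above it. Equality is what later identifies the second Oseledets exponent as the
    largest exceptional one. *)
Lemma exc_spectrumE : ess_upper T d w = (ln 3^-1)%:E ->
  exc_spectrum T d w = [set x | exists j, delta j < 1 /\ x = (ln (delta j))%:E].
Proof.
move=> eu; have d0 j : 0 < delta j by apply: lt_trans (delta_gt j); rewrite invr_gt0.
have dlt j : (ln (delta j) < 0) = (delta j < 1) by rewrite -[X in _ < X]ln1 ltr_ln ?posrE.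
apply/seteqP; split => x; rewrite /exc_spectrum /= eu.
  move=> [[f fBV <-] [h1 h2]]; have [[j jE]|h] := lyap_alternative fBV.
    by exists j; move: h2; rewrite jE lte_fin dlt.
  by move: h1; rewrite ltNge h.
move=> [j [dj ->]]; rewrite !lte_fin dlt dj ltr_ln ?posrE ?invr_gt0// delta_gt; split => //.
exists (vecfun (breaks R M) (row j (V (wn 0)))); first exact: vecfun_inBV.
exact: lyap_eigenfunction.
Qed.

End System.

(** * Expansion, Markov property, invariance of Lebesgue measure *)

Section MapProperties.
Variables (R : realType) (M : nat) (t : nat -> nat).
Hypothesis M_gt0 : (0 < M)%N.
Hypothesis t_lt : forall p, (p < 3 * M)%N -> (t p < M)%N.
Local Notation mu := (@lebesgue_measure R).

Let MR : 0 < M%:R :> R. Proof. by rewrite ltr0n. Qed.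
Let K_gt0 : (0 < 3 * M)%N. Proof. by rewrite muln_gt0. Qed.

Lemma breaks_partition : is_partition (breaks R M) M.
Proof.
split => //; first by rewrite /breaks mul0r.
  by rewrite /breaks divff// gt_eqF.
by move=> k kM; rewrite /breaks ltr_pM2r ?invr_gt0// ltr_nat.
Qed.

Lemma bmap_expanding : is_pa_expanding (bmap M t) (bdata R M t).
Proof.
have KR : 0 < (3 * M)%:R :> R by rewrite ltr0n.
split; split => //=.
- by rewrite mul0r.
- by rewrite divff// gt_eqF.
- by move=> i iK; rewrite ltr_pM2r ?invr_gt0// ltr_nat.
- by move=> i _; rewrite ger0_norm// ltr1n.
- move=> i x /in_pieceE -/(_ M_gt0) [iK [u /andP[u0 u1] ->]].
  have u01 : 0 <= u < 1 by rewrite ltW.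
  rewrite bmap_pt// addrC.
  have -> : 3 * pt (3 * M) i u + ((t i)%:R - i%:R) / M%:R = pt M (t i) u.
    by rewrite /pt natrM; field; rewrite gt_eqF.
  have /andP[h0 h1] := ptI01 (t_lt iK) u01.
  by rewrite /fracR (floor_def (m := 0)) ?subr0// h0 add0r.
- move=> x xI; have [p [u [pK u01 ->]]] := I01_pt K_gt0 xI.
  by rewrite bmap_pt//; apply: ptI01 => //; exact: t_lt.
Qed.

Lemma Bint_pt k (x : R) : Bint (breaks R M) k x -> exists2 u, 0 < u < 1 & x = pt M k u.
Proof.
rewrite /Bint /= /breaks => /andP[h1 h2]; exists (M%:R * x - k%:R).
  move: h1 h2; rewrite ltr_pdivrMr// ltr_pdivlMr// -natr1 => h1 h2.
  by rewrite subr_gt0 mulrC h1 ltrBlDr addrC.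
by rewrite /pt subrKC mulrC mulKf// gt_eqF.
Qed.

Lemma pt_Bint k (u : R) : 0 < u < 1 -> Bint (breaks R M) k (pt M k u).
Proof.
move=> /andP[u0 u1].
by rewrite /Bint/= /breaks /pt !ltr_pM2r ?invr_gt0// ltrDl u0 -natr1 ltrD2l.
Qed.

(** A point of cell [j] landing in cell [k] lies in a piece of cell [j] sent to cell [k], and the
    interior of that piece already covers the whole open cell. *)
Lemma bmap_markov : is_markov (bmap M t) (breaks R M) M.
Proof.
move=> j k jM kM [y [/Bint_pt[u u01 ->] [x /Bint_pt[v v01 ->]]]].
have v01' : 0 <= v < 1 by case/andP: v01 => v0 v1; rewrite ltW.
have u01' : 0 <= u < 1 by case/andP: u01 => u0 u1; rewrite ltW.
have xI : I01 (pt M j v) by exact: ptI01.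
have [p [s [pK s01 xE]]] := I01_pt K_gt0 xI.
rewrite xE bmap_pt// => /(pt_inj M_gt0 s01 u01')[tp _] z /Bint_pt[r r01 ->].
have r01' : 0 <= r < 1 by case/andP: r01 => r0 r1; rewrite ltW.
have jp : j = (p %/ 3)%N.
  move: xE; rewrite pt_refine// => /(pt_inj M_gt0 v01' _)[]//.
  exact: refine01.
exists (pt (3 * M) p r); last by rewrite bmap_pt ?tp.
rewrite pt_refine// -jp; apply: pt_Bint; case/andP: r01 => r0 r1.
have : (p %% 3 <= 2)%N by rewrite -ltnS ltn_pmod.
rewrite -(ler_nat R) => p2; have p0 : 0 <= (p %% 3)%:R :> R by [].
by apply/andP; split; lra.
Qed.

Hypothesis t_fibre : forall k, (k < M)%N -> (\sum_(p < 3 * M) (t p == k) = 3)%N.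

(** The preimage is the disjoint union, over the pieces, of copies of [E] intersected with a cell,
    contracted by 1/3; by [t_fibre] every cell is counted three times. *)
Lemma bmap_preserves_leb : preserves_leb (@bmap R M t).
Proof.
move=> E mE EI.
have MR0 : M%:R != 0 :> R by rewrite gt_eqF.
pose cell (N k : nat) : set R := [set x | k%:R / N%:R <= x < k.+1%:R / N%:R].
have mcell N k : measurable (cell N k).
  rewrite (_ : cell N k = `[k%:R / N%:R, k.+1%:R / N%:R[%classic); first exact: measurable_itv.
  by apply/seteqP; split => x /=; rewrite in_itv.
have cellP (N k : nat) x : (0 < N)%N -> cell N k x <-> exists2 u, 0 <= u < 1 & x = pt N k u.
  move=> N0; have NR : 0 < N%:R :> R by rewrite ltr0n.
  rewrite /cell /=; split => [/andP[h1 h2]|[u /andP[u0 u1] ->]].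
    exists (N%:R * x - k%:R).
      move: h1 h2; rewrite ler_pdivrMr// ltr_pdivlMr// -natr1 => h1 h2.
      by rewrite subr_ge0 mulrC h1 ltrBlDr addrC.
    by rewrite /pt subrKC mulrC mulKf// gt_eqF.
  by rewrite /pt ler_pM2r ?invr_gt0// ltr_pM2r ?invr_gt0// lerDl u0 -natr1 ltrD2l.
have tcell N (F : nat -> set R) : (0 < N)%N -> (forall k, F k `<=` cell N k) -> trivIset setT F.
  move=> N0 Fc; apply/trivIsetP => i j _ _ ij; apply/seteqP; split => // x [/Fc ci /Fc cj].
  have [u u01 xE] := (cellP N i x N0).1 ci; have [v v01 xE'] := (cellP N j x N0).1 cj.
  by move: ij; rewrite xE in xE'; have [-> _] := pt_inj N0 u01 v01 xE'; rewrite eqxx.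
pose F p := affpre 3 (((t p)%:R - p%:R) / M%:R) (E `&` cell M (t p)).
have mF p : measurable (F p) by apply: measurable_affpre; exact: measurableI.
have FE p x : F p x <-> exists2 u, 0 <= u < 1 & x = pt (3 * M) p u /\ E (pt M (t p) u).
  split; rewrite /F /affpre /=.
    move=> [Ex /(cellP _ _ _ M_gt0)[u u01 xu]]; exists u => //; rewrite -xu; split => //.
    have -> : x = 3^-1 * (pt M (t p) u - ((t p)%:R - p%:R) / M%:R) by rewrite -xu; field.
    by rewrite /pt natrM; field.
  move=> [u u01 [-> Eu]].
  have -> : 3 * pt (3 * M) p u + ((t p)%:R - p%:R) / M%:R = pt M (t p) u.
    by rewrite /pt natrM; field.
  by split => //; apply/(cellP _ _ _ M_gt0); exists u.
have -> : @I01 R `&` bmap M t @^-1` E = \big[setU/set0]_(p < 3 * M) F p.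
  apply/seteqP; split => x.
    move=> [xI /= Ex]; have [p [u [pK u01 xE]]] := I01_pt K_gt0 xI.
    rewrite -(bigcup_mkord _ F); exists p => //; apply/FE; exists u => //; split => //.
    by move: Ex; rewrite xE bmap_pt.
  rewrite -(bigcup_mkord _ F) => -[p /= pK /FE[u u01 [-> Eu]]].
  by split; [exact: ptI01|rewrite /= bmap_pt].
have EE : E = \big[setU/set0]_(k < M) (E `&` cell M k).
  rewrite -(bigcup_mkord _ (fun k => E `&` cell M k)); apply/seteqP; split => x; last by move=> [k _ []].
  move=> Ex; have [k [u [kM u01 xE]]] := I01_pt M_gt0 (EI _ Ex).
  by exists k => //; split => //; apply/(cellP _ _ _ M_gt0); exists u.
pose nu : {measure set (measurableTypeR R) -> \bar R} := @lebesgue_measure R.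
rewrite [LHS](measure_bigsetU nu mF); last first.
  apply: (@tcell (3 * M)%N) => // p x /FE[u u01 [-> _]].
  by apply/cellP => //; exists u.
have mC k : measurable (E `&` cell M k) by exact: measurableI.
rewrite [in RHS]EE [RHS](measure_bigsetU nu mC); last first.
  by apply: (@tcell M) => // k x [].
transitivity (\sum_(p < 3 * M) (3^-1)%:E * nu (E `&` cell M (t p)))%E.
  by apply: eq_bigr => p _; rewrite [LHS]lebesgue_measure_affpre//; exact: measurableI.
rewrite -ge0_sume_distrr//.
transitivity ((3^-1)%:E * \sum_(k < M) \sum_(p < 3 * M | t p == k) nu (E `&` cell M k))%E.
  congr (_ * _)%E; rewrite (exchange_big_dep xpredT)//=; apply: eq_bigr => p _.
  by rewrite (big_pred1 (Ordinal (t_lt (ltn_ord p)))).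
rewrite ge0_sume_distrr//; last by move=> k _; apply: sume_ge0.
apply: eq_bigr => k _.
have card3 : #|[pred p : 'I_(3 * M) | t p == k]| = 3%N.
  by rewrite -sum1_card big_mkcond/= -[RHS](t_fibre (ltn_ord k)); apply: eq_bigr => p _;
    rewrite inE; case: eqP.
have third (x : \bar R) : (0 <= x)%E -> ((3^-1)%:E * (x *+ 3)%R)%E = x.
  rewrite [(x *+ 3)%R]mulrS mulr2n; case: x => [r _| |//].
    have -> : (r%:E + (r%:E + r%:E))%R = (r + (r + r))%:E by [].
    by rewrite -EFinM; apply/eqP; rewrite eqe; apply/eqP; field.
  by move=> _; rewrite mulry gtr0_sg ?mul1e// invr_gt0.
by rewrite sumr_const card3 third//; exact: measure_ge0.
Qed.

Lemma DPhi_regular (T : nat -> R -> R) (d : nat -> pa_data R) w n x :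
  (forall k, exists s, d k = bdata R M s) ->
  regular_orbit T d w x -> DPhi T d w n x = 3 ^+ n.
Proof.
move=> dE [_ reg]; rewrite /DPhi -[n in RHS]card_ord -prodr_const.
apply: eq_bigr => k _.
have [i ip] := reg k; have [s sE] := dE (w k%:Z).
move: ip; rewrite sE => /in_pieceE - /(_ M_gt0) [iK [u /andP[u0 u1] ->]].
rewrite /dslope (bigD1 (Ordinal iK))//= big1 ?addr0.
  by rewrite ifT//; apply/in_pieceE => //; split => //; exists u => //; rewrite u0.
move=> j ji; case: ifPn => // /in_pieceE - /(_ M_gt0) [_ [v /andP[v0 v1] e]].
have [ij _] : i = j /\ u = v by apply: pt_inj e => //; rewrite ltW.
by case/eqP: ji; apply/val_inj.
Qed.


End MapProperties.

(** * Essential upper bound and essential spectral radius *)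

Section UniformSlope.
Variables (R : realType) (M : nat) (t : nat -> nat -> nat).
Hypothesis M_gt0 : (0 < M)%N.
Let T i := @bmap R M (t i).
Let d i := bdata R M (t i).
Variable w : int -> nat.
Hypothesis t_lt : forall n : nat, forall p, (p < 3 * M)%N -> (t (w n%:Z) p < M)%N.

(* Midpoints of cells are mapped to midpoints of cells. *)
Lemma regular_orbit_midpoint : regular_orbit T d w (pt M 0 2^-1).
Proof.
have h : 0 < 2^-1 :> R /\ 2^-1 < 1 :> R by split; lra.
have h01 : 0 <= (2^-1 : R) < 1 by case: h => h0 h1; rewrite ltW.
have orb n : exists2 k, (k < M)%N & Phi T w n (pt M 0 2^-1) = pt M k 2^-1.
  elim: n => [|n [k kM IH]]; first by exists 0%N.
  exists (t (w n%:Z) (3 * k).+1); first by apply: t_lt; lia.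
  have e : pt M k 2^-1 = pt (3 * M) (3 * k).+1 2^-1 :> R.
    have MR : M%:R != 0 :> R by rewrite pnatr_eq0 -lt0n.
    by rewrite /pt -[(3 * k).+1%:R]natr1 !natrM; field.
  by rewrite /= IH e /T bmap_pt.
split; first exact: ptI01.
move=> n; have [k kM ->] := orb n; exists (3 * k).+1; apply/in_pieceE => //; split; first lia.
exists 2^-1; first by apply/andP.
have MR : M%:R != 0 :> R by rewrite pnatr_eq0 -lt0n.
by rewrite /pt -[(3 * k).+1%:R]natr1 !natrM; field.
Qed.

(** Every regular orbit expands at rate 3. The orbit of a midpoint shows that there are regular
    orbits, so that the infimum is over a singleton and not over the empty set. *)
Lemma ess_upper_ln3 : ess_upper T d w = (ln 3^-1)%:E.
Proof.
rewrite /ess_upper.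
have DE n x : regular_orbit T d w x -> DPhi T d w n x = 3 ^+ n.
  by apply: (DPhi_regular M_gt0) => k; exists (t k).
have -> : [set limn_esup (fun n : nat => (n%:R^-1)%:E * elog `|DPhi T d w n x|)%E
     | x in regular_orbit T d w] = [set (ln 3)%:E].
  apply/seteqP; split => [_ [x xreg <-]|_ ->].
    apply: (cvg_limn_einf_sup _).2.
    apply: (@growth_rate R (fun n => `|DPhi T d w n x|%:E) 1 1 3) => //.
    by apply: nearW => n; rewrite DE// !mul1r ger0_norm ?exprn_ge0// lexx.
  exists (pt M 0 2^-1); first exact: regular_orbit_midpoint.
  apply: (cvg_limn_einf_sup _).2.
  apply: (@growth_rate R (fun n => `|DPhi T d w n (pt M 0 2^-1)|%:E) 1 1 3) => //.
  by apply: nearW => n; rewrite DE ?mul1r ?ger0_norm ?exprn_ge0 ?lexx//; exact: regular_orbit_midpoint.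
by rewrite ereal_inf1 -EFinN lnV// posrE.
Qed.

End UniformSlope.

Section Theta.
Variables (R : realType) (M : nat) (t : nat -> nat).
Hypothesis M_gt0 : (0 < M)%N.
Hypothesis t_lt : forall p, (p < 3 * M)%N -> (t p < M)%N.

Lemma theta_map_bmap : theta_map (@bmap R M t) (bdata R M t) = 3^-1.
Proof.
rewrite /theta_map; apply: cvg_lim => //.
apply: (@cvg_trans _ ((fun=> 3^-1) @ \oo)); last exact: cvg_cst.
apply: near_eq_cvg; near=> n.
(* At [n = 0] the inverse is 0 by convention and the power would be 1. *)
have n0 : n%:R != 0 :> R by rewrite pnatr_eq0 -lt0n; near: n; exact: nbhs_infty_gt.
set S := [set _ | _ in _].
have -> : S = [set 3^-1].
  have val x : regular_orbit (fun=> bmap M t) (fun=> bdata R M t) (fun=> 0%N) x ->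
      `|DPhi (fun=> bmap M t) (fun=> bdata R M t) (fun=> 0%N) n x| `^ (- n%:R^-1) = 3^-1.
    move=> xr; rewrite (DPhi_regular M_gt0 _ _ xr); last by move=> k; exists t.
    rewrite ger0_norm ?exprn_ge0// -powR_mulrn// -powRrM mulrN mulfV// powR_inv1//.
  apply/seteqP; split => [_ [x xr <-]|_ ->]; first exact: val.
  have xr := @regular_orbit_midpoint R M (fun=> t) M_gt0 (fun=> 0%N) (fun _ => t_lt).
  by exists (pt M 0 2^-1) => //; exact: val.
by rewrite sup1.
Unshelve. all: end_near. Qed.

End Theta.

(** * Oseledets decomposition *)

Section Idempotents.
Variables (F : fieldType) (n l : nat) (E : 'I_l -> 'M[F]_n).
Hypothesis EE : forall i j, E i *m E j = if i == j then E i else 0.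
Hypothesis sumE : \sum_i E i = 1%:M.

Lemma idempotents_sum : (\sum_i E i :=: 1%:M)%MS.
Proof.
apply/eqmxP; rewrite submx1 -sumE/=.
by apply: summx_sub => i _; exact: sumsmx_sup.
Qed.

(** A row vector of [E i] is fixed by [E i], while the row spaces of the other idempotents are
    killed by it; the intersection is therefore zero. *)
Lemma idempotents_mxdirect : mxdirect (\sum_i E i).
Proof.
apply/mxdirect_sumsP => i _; set X := (_ :&: _)%MS.
have /submxP[Y XY] : (X <= E i)%MS by exact: capmxSl.
have : (X <= kermx (E i))%MS.
  apply: submx_trans (capmxSr _ _) _; apply/sumsmx_subP => j ji.
  by rewrite sub_kermx EE (negPf ji).
by rewrite sub_kermx => /eqP <-; rewrite {2}XY -mulmxA EE eqxx.
Qed.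

End Idempotents.

Section Oseledets.
Variables (R : realType) (M m : nat).
Variables (A : nat -> 'M[R]_M) (Psi : nat -> 'M[R]_(M, m)) (V : nat -> 'M[R]_(m, M)).
Variables (delta : 'I_m -> R) (B : R) (Om : set (int -> nat)).
Hypothesis m_lt : (m < M)%N.
Hypothesis delta_gt0 : forall j, 0 < delta j.
Hypothesis delta_strict : forall i j : 'I_m, (i < j)%N -> delta j < delta i.
Hypothesis APsi : forall w, Om w -> forall n : nat,
  A (w n%:Z) *m Psi (w n.+1%:Z) = Psi (w n%:Z) *m dpow delta 1.
Hypothesis VA : forall w, Om w -> forall n : nat,
  V (w n%:Z) *m A (w n%:Z) = dpow delta 1 *m V (w n.+1%:Z).
Hypothesis VPsi : forall w, Om w -> forall n : nat, V (w n%:Z) *m Psi (w n%:Z) = 1%:M.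
Hypothesis A6 : forall w, Om w ->
  mcocycle A w 6 = Psi (w 0) *m dpow delta 6 *m V (w 0).
Hypothesis B_ge : forall w, Om w -> forall n : nat,
  nrm (Psi (w n%:Z)) <= B /\ nrm (V (w n%:Z)) <= B.
Hypothesis B_gt0 : 0 < B.

Definition osel_exponent (j : nat) : \bar R :=
  if insub j is Some i then (ln (delta i))%:E else -oo%E.

(** The row spaces of the rank-one spectral projections; the default branch, used for the index [m],
    is the complementary projection, whose row space is the kernel of [Psi i] acting on row
    vectors. *)
Definition osel_space (i j : nat) : 'M[R]_M :=
  if insub j is Some k then Psi i *m delta_mx k k *m V i else 1%:M - Psi i *m V i.

Let spaceE i (k : 'I_m) : osel_space i k = Psi i *m delta_mx k k *m V i.
Proof. by rewrite /osel_space valK. Qed.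
Let spacemE i : osel_space i m = 1%:M - Psi i *m V i.
Proof. by rewrite /osel_space insubN ?ltnn. Qed.

Lemma osel_space_orthogonal i (j k : 'I_m.+1) : V i *m Psi i = 1%:M ->
  osel_space i j *m osel_space i k = if j == k then osel_space i j else 0.
Proof.
move=> VP.
have PP (X Y : 'M[R]_m) : Psi i *m X *m V i *m (Psi i *m Y *m V i) = Psi i *m (X *m Y) *m V i.
  by rewrite -!mulmxA (mulmxA (V i)) VP mul1mx !mulmxA.
have K1 (X : 'M[R]_m) : Psi i *m X *m V i *m (1%:M - Psi i *m V i) = 0.
  by rewrite mulmxBr mulmx1 -!mulmxA (mulmxA (V i)) VP mul1mx subrr.
have K2 (X : 'M[R]_m) : (1%:M - Psi i *m V i) *m (Psi i *m X *m V i) = 0.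
  by rewrite mulmxBl mul1mx -!mulmxA (mulmxA (V i)) VP mul1mx subrr.
have K3 : (1%:M - Psi i *m V i) *m (1%:M - Psi i *m V i) = 1%:M - Psi i *m V i.
  by rewrite mulmxBr mulmx1 mulmxBl mul1mx -!mulmxA (mulmxA (V i)) VP mul1mx subrr subr0.
case: (unliftP ord_max j) => [j' ->|->]; case: (unliftP ord_max k) => [k' ->|->];
  rewrite ?lift_max ?spaceE ?spacemE ?K1 ?K2 ?K3 ?eqxx.
- rewrite PP mul_delta_mx_cond (inj_eq lift_inj).
  by case: eqVneq => [->|_]; rewrite ?mulr1n// mulr0n mulmx0 mul0mx.
- by rewrite eq_sym (negPf (neq_lift _ _)).
- by rewrite (negPf (neq_lift _ _)).
- by [].
Qed.

Lemma osel_space_sum i : \sum_(j < m.+1) osel_space i j = 1%:M.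
Proof.
rewrite big_ord_recr/= spacemE.
under eq_bigr do rewrite spaceE.
by rewrite -mulmx_suml -mulmx_sumr -mx1_sum_delta mulmx1 subrKC.
Qed.

Lemma eqmx_Psi i p (X : 'M[R]_(m, p)) : V i *m Psi i = 1%:M -> (Psi i *m X :=: X)%MS.
Proof.
move=> VP; apply/eqmxP/andP; split; first exact: submxMl.
by rewrite -{1}[X]mul1mx -VP -mulmxA submxMl.
Qed.

Lemma dpowD a b : dpow delta a *m dpow delta b = dpow delta (a + b).
Proof. by rewrite mulmx_diag; congr diag_mx; apply/rowP => j; rewrite !mxE exprD. Qed.

Lemma V_mcocycle w n : Om w -> V (w 0) *m mcocycle A w n = dpow delta n *m V (w n%:Z).
Proof.
move=> Ow; elim: n => [|n IH] /=.
  rewrite mulmx1; have -> : dpow delta 0 = 1%:M; last by rewrite mul1mx.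
  by apply/matrixP => i j; rewrite !mxE expr0.
by rewrite mulmxA IH -mulmxA VA// mulmxA dpowD addn1.
Qed.

Lemma vnorm_le_nrm n (v : 'rV[R]_n) : vnorm v <= nrm v.
Proof.
rewrite /vnorm; elim/big_ind: _ => [|x y x1 y1|k _]; first exact: nrm_ge0.
  by rewrite ge_max x1.
exact: nrm_entry.
Qed.

Lemma nrm_le_vnorm n (v : 'rV[R]_n) : nrm v <= n%:R * vnorm v.
Proof.
rewrite /nrm big_ord1 mulr_natl -[X in _ *+ X]card_ord -sumr_const.
by apply: ler_sum => k _; rewrite /vnorm (bigD1 k)//= le_max lexx.
Qed.

(** The orbit of [v] is a scalar times [delta j ^+ n] times row [j] of the current [V]. That row is
    bounded, and bounded below by [1/B] because its product with [Psi] has an entry 1. *)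
Lemma osel_growth w (j : 'I_m) (v : 'rV[R]_M) : Om w -> (v <= osel_space (w 0%:Z) j)%MS -> v != 0 ->
  (((n%:R)^-1)%:E * elog (vnorm (v *m mcocycle A w n)))%E @[n --> \oo] --> (ln (delta j))%:E.
Proof.
move=> Ow /submxP[a ->]; rewrite spaceE => v0.
pose x := (a *m Psi (w 0)) 0 j.
have vE n : a *m (Psi (w 0) *m delta_mx j j *m V (w 0)) *m mcocycle A w n =
    (x * delta j ^+ n) *: row j (V (w n%:Z)).
  rewrite -!mulmxA V_mcocycle// !mulmxA; apply/rowP => k.
  rewrite mxE [RHS]mxE [row _ _ _ _]mxE (bigD1 j)//= big1 ?addr0.
    rewrite mul_mx_diag mxE (mxE _ _ 0 j) (bigD1 j)//= big1 ?addr0.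
      by rewrite !mxE !eqxx mulr1 /x !mxE.
    by move=> i ij; rewrite [delta_mx _ _ _ _]mxE (negPf ij) mulr0.
  move=> i ij; rewrite mul_mx_diag mxE (mxE _ _ 0 i) big1 ?mul0r// => i' _.
  by rewrite [delta_mx _ _ _ _]mxE (negPf ij) andbF mulr0.
have x0 : x != 0.
  apply: contraNneq v0 => x0; have := vE 0%N; rewrite /= mulmx1 => ->.
  by rewrite x0 mul0r scale0r.
have M0 : 0 < M%:R :> R by rewrite ltr0n (leq_ltn_trans _ m_lt).
have nrmZ c (u : 'rV[R]_M) : nrm (c *: u) = `|c| * nrm u.
  by rewrite /nrm !big_ord1 mulr_sumr; apply: eq_bigr => k _; rewrite mxE normrM.
have Vlo n : B^-1 <= nrm (row j (V (w n%:Z))).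
  rewrite -[B^-1]mul1r ler_pdivrMr//.
  have e : (row j (V (w n%:Z)) *m Psi (w n%:Z)) 0 j = 1.
    by rewrite -row_mul VPsi// !mxE eqxx.
  have := nrm_entry (row j (V (w n%:Z)) *m Psi (w n%:Z)) 0 j; rewrite e normr1.
  move=> /le_trans; apply; apply: le_trans (nrmM _ _) _; rewrite ler_wpM2l ?nrm_ge0//.
  by have [] := B_ge Ow n.
have Vup n : nrm (row j (V (w n%:Z))) <= B.
  have [_ +] := B_ge Ow n; apply: le_trans; rewrite /nrm big_ord1 [leRHS](bigD1 j)//=.
  rewrite (eq_bigr (fun k => `|V (w n%:Z) j k|)); last by move=> k _; rewrite mxE.
  by rewrite lerDl sumr_ge0// => i _; exact: sumr_ge0.
apply: (@growth_rate R (fun n => (vnorm (a *m (Psi (w 0) *m delta_mx j j *m V (w 0)) *m mcocycle A w n))%:E)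
  (`|x| * B^-1 / M%:R) (`|x| * B)) => //.
- by rewrite !mulr_gt0 ?normr_gt0 ?invr_gt0.
- by rewrite mulr_gt0 ?normr_gt0.
apply: nearW => n; rewrite !lee_fin vE.
have d0 : 0 <= delta j ^+ n by rewrite exprn_ge0// ltW.
apply/andP; split.
  rewrite mulrAC ler_pdivrMr// [leRHS]mulrC; apply: le_trans (nrm_le_vnorm _).
  by rewrite nrmZ normrM (ger0_norm d0) mulrAC ler_wpM2l// mulr_ge0.
apply: le_trans (vnorm_le_nrm _) _.
by rewrite nrmZ normrM (ger0_norm d0) mulrAC ler_wpM2r// ler_wpM2l.
Qed.

Lemma osel_collapse w (v : 'rV[R]_M) : Om w -> (v <= osel_space (w 0%:Z) m)%MS ->
  (((n%:R)^-1)%:E * elog (vnorm (v *m mcocycle A w n)))%E @[n --> \oo] --> -oo%E.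
Proof.
move=> Ow /submxP[a ->]; rewrite spacemE; set v' := a *m _.
have v6 : v' *m mcocycle A w 6 = 0.
  by rewrite A6// /v' mulmxBr mulmx1 mulmxBl !mulmxA -[_ *m V _ *m Psi _]mulmxA (VPsi Ow 0) mulmx1 subrr.
have vn n : v' *m mcocycle A w (n + 6) = 0.
  by elim: n => [|n IH]; [exact: v6|rewrite addSn [mcocycle _ _ _]/= mulmxA IH mul0mx].
apply: (@cvg_trans _ ((fun=> -oo%E : \bar R) @ \oo)); last exact: cvg_cst.
apply: near_eq_cvg; near=> n.
have n6 : (6 <= n)%N by near: n; exact: nbhs_infty_ge.
rewrite -{2}(subnK n6) vn.
have -> : vnorm (0 : 'rV[R]_M) = 0.
  rewrite /vnorm; elim/big_ind: _ => // [x y -> ->|k _]; first by rewrite maxxx.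
  by rewrite mxE normr0.
rewrite /elog eqxx mulrNy gtr0_sg ?mul1e// invr_gt0 ltr0n.
exact: leq_trans n6.
Unshelve. all: end_near. Qed.

Lemma oseledets_spaces : oseledets A Om m.+1 osel_exponent (fun w => osel_space (w 0)).
Proof.
split.
  move=> j; rewrite ltnS => jm; rewrite /osel_exponent (insubT (fun i => i < m)%N jm).
  case: (ltnP j.+1 m) => jm'; last by rewrite insubN ?ltNyr// -leqNgt.
  by rewrite (insubT (fun i => i < m)%N jm') lte_fin ltr_ln ?posrE// delta_strict.
move=> w Ow; have VP0 := VPsi Ow 0; have VP1 := VPsi Ow 1.
split.
- by apply: idempotents_sum; exact: osel_space_sum.
- by apply: idempotents_mxdirect => j k; exact: osel_space_orthogonal.
move=> j; rewrite ltnS leq_eqVlt => /orP[/eqP ->|jm]; last first.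
  pose k := Ordinal jm; rewrite -[j]/(nat_of_ord k).
  have eqA : (osel_space (w 0) k *m A (w 0) :=: osel_space (sshift w 0) k)%MS.
    rewrite !spaceE -[w 0]/(w 0%:Z) -!mulmxA (VA Ow 0).
    have -> : delta_mx k k *m (dpow delta 1 *m V (w 1)) = delta k *: (delta_mx k k *m V (w 1)).
      rewrite mulmxA scalemxAl; congr (_ *m _); apply/matrixP => a b.
      by rewrite mul_mx_diag !mxE expr1 mulrC; case: (eqVneq b k) => [->//|_]; rewrite andbF !mulr0.
    apply: eqmx_trans (eqmx_Psi _ VP0) _.
    apply: eqmx_trans (eqmx_scale _ _) _; first by rewrite gt_eqF.
    exact: eqmx_sym (eqmx_Psi _ VP1).
  split => //.
  - apply/eqP; rewrite spaceE => /(congr1 (fun X => V (w 0) *m X *m Psi (w 0))).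
    rewrite !mulmxA VP0 mul1mx -mulmxA VP0 mulmx1 mulmx0 mul0mx => /matrixP/(_ k k).
    by rewrite !mxE !eqxx; move/eqP; rewrite oner_eq0.
  - by rewrite eqA.
  - move=> v vW v0; rewrite /osel_exponent valK; exact: osel_growth.
split.
(* [Psi V] has rank at most [m < M], so it is not the identity. *)
- rewrite spacemE subr_eq0; apply/eqP => e.
  have := mxrankM_maxl (Psi (w 0)) (V (w 0)); rewrite -e mxrank1 => h.
  by have := leq_trans h (rank_leq_col _); rewrite leqNgt m_lt.
(* Inclusion in the row space of a projection is shown by checking that the projection fixes the
   image. *)
- have e : (osel_space (w 0) m *m A (w 0)) *m osel_space (sshift w 0) m =
      osel_space (w 0) m *m A (w 0).
    have -> : osel_space (w 0) m *m A (w 0) = A (w 0) - Psi (w 0) *m (dpow delta 1 *m V (w 1)).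
      by rewrite spacemE mulmxBl mul1mx -mulmxA (VA Ow 0).
    rewrite spacemE -[sshift w 0]/(w 1%:Z) mulmxBr mulmx1.
    rewrite (mulmxA _ (Psi _) (V _)) mulmxBl (APsi Ow 0).
    rewrite -[_ *m Psi (w 1%:Z)]mulmxA -[_ *m Psi (w 1%:Z)]mulmxA.
    by rewrite VP1 mulmx1 subrr mul0mx subr0.
  by rewrite -e submxMl.
- by rewrite /osel_exponent insubN ?ltnn.
- by move=> v vW _; rewrite /osel_exponent insubN ?ltnn//; exact: osel_collapse.
Qed.

End Oseledets.

(** * Spectral data of the cycle carried to every phase *)

Section CyclicFactorization.
Variables (R : realType) (M n m : nat).
Variables (L : nat -> 'M[R]_(M, n)) (P : nat -> 'M[R]_(n, M)).
Variables (U : 'M[R]_(m, n)) (Ut : 'M[R]_(n, m)) (delta : 'I_m -> R).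

Definition nxt (i : nat) : nat := (i %% 3).+1.

Definition phase i := [\/ i = 1%N, i = 2%N | i = 3%N].

Variables (C : nat -> 'M[R]_n) (A : nat -> 'M[R]_M).
Hypothesis PL : forall i, phase i -> P i *m L i = C i.
Hypothesis AE : forall i, phase i -> A i = L i *m P (nxt i).

Hypothesis delta_gt0 : forall j, 0 < delta j.
Hypothesis UUt : U *m Ut = 1%:M.
Hypothesis CE : C 1%N *m C 2%N *m C 3%N = Ut *m dpow delta 3 *m U.

Let D := dpow delta 1.
Let Di : 'M[R]_m := diag_mx (\row_j (delta j)^-1).

Let DDi : D *m Di = 1%:M.
Proof.
apply/matrixP => i j; rewrite mul_mx_diag !mxE expr1.
by case: eqVneq => [->|_]; rewrite ?mulr0n ?mul0r// !mulr1n mulfV// gt_eqF.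
Qed.

Let DiD : Di *m D = 1%:M.
Proof. by rewrite diag_mxC DDi. Qed.

Let D3 : dpow delta 3 = D *m D *m D.
Proof. by rewrite /D !dpowD. Qed.

Let CK q (X : 'M[R]_(q, n)) : X *m C 1%N *m C 2%N *m C 3%N = X *m Ut *m D *m D *m D *m U.
Proof. by rewrite -!mulmxA (mulmxA (C 1%N)) CE D3 !mulmxA. Qed.
Let UK q (X : 'M[R]_(q, m)) : X *m U *m Ut = X.
Proof. by rewrite -mulmxA UUt mulmx1. Qed.
Let DDK q (X : 'M[R]_(q, m)) : X *m D *m Di = X.
Proof. by rewrite -mulmxA DDi mulmx1. Qed.
Let DiDK q (X : 'M[R]_(q, m)) : X *m Di *m D = X.
Proof. by rewrite -mulmxA DiD mulmx1. Qed.
Let cancel := (CK, UK, DDK, DiDK, DDi, DiD, mul1mx).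

(** Left eigenvectors of the cycle at phase 1 are carried forward by the [C i], right eigenvectors
    backward. The inverse rates spread the growth [delta j ^+ 3] of a cycle evenly over its three
    steps. *)
Let lrow i : 'M[R]_(m, n) :=
  if i == 1%N then U else if i == 2%N then Di *m U *m C 1%N else Di *m Di *m U *m C 1%N *m C 2%N.
Let rcol i : 'M[R]_(n, m) :=
  if i == 1%N then Ut else if i == 2%N then C 2%N *m C 3%N *m Ut *m Di *m Di else C 3%N *m Ut *m Di.

Definition cyc_V i : 'M[R]_(m, M) := lrow i *m P i.
(** Pairing [cyc_V i] with [L i] produces an additional factor [C i], which acts on the eigenvectors
    as [D]; [Di] removes it and restores duality. *)
Definition cyc_Psi i : 'M[R]_(M, m) := L i *m rcol (nxt i) *m Di.

Let lrowC i : phase i -> lrow i *m C i = D *m lrow (nxt i).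
Proof. by case=> ->; rewrite /lrow /nxt /= ?mulmxA ?cancel. Qed.

Let Crcol i : phase i -> C i *m rcol (nxt i) = rcol i *m D.
Proof.
case=> ->; rewrite /rcol /nxt /= ?mulmxA ?cancel//.
by rewrite CE D3 !mulmxA !cancel.
Qed.

Let lr i : phase i -> lrow i *m rcol i = 1%:M.
Proof. by case=> ->; rewrite /lrow /rcol /= ?UUt// !mulmxA !cancel. Qed.

Let nxt_phase i : phase i -> phase (nxt i).
Proof. by case=> ->; [constructor 2|constructor 3|constructor 1]. Qed.

Lemma cyc_APsi i : phase i -> A i *m cyc_Psi (nxt i) = cyc_Psi i *m D.
Proof.
move=> ip; have np := nxt_phase ip.
rewrite AE// /cyc_Psi !mulmxA -[_ *m P _ *m L _]mulmxA PL//.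
by rewrite -[_ *m C _ *m _]mulmxA Crcol// !mulmxA !cancel.
Qed.

Lemma cyc_VA i : phase i -> cyc_V i *m A i = D *m cyc_V (nxt i).
Proof.
by move=> ip; rewrite AE// /cyc_V mulmxA -[_ *m P i *m L i]mulmxA PL// lrowC// mulmxA.
Qed.

Lemma cyc_VPsi i : phase i -> cyc_V i *m cyc_Psi i = 1%:M.
Proof.
move=> ip; rewrite /cyc_V /cyc_Psi !mulmxA -[_ *m P i *m L i]mulmxA PL//.
by rewrite -[_ *m C i *m _]mulmxA Crcol// mulmxA lr// mul1mx DDi.
Qed.

(** Between the outer factors [L 3] and [P 1] stands the whole cycle [C 1], [C 2], [C 3], and its
    spectral factorization through [Ut] and [U] drops the null direction. *)
Let A4 : A 3%N *m A 1%N *m A 2%N *m A 3%N = cyc_Psi 3%N *m dpow delta 4 *m cyc_V 1%N.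
Proof.
have p1 : phase 1%N by constructor 1.
have p2 : phase 2%N by constructor 2.
have p3 : phase 3%N by constructor 3.
have -> : dpow delta 4 = D *m dpow delta 3 by rewrite /D dpowD.
rewrite /cyc_Psi /cyc_V /rcol /lrow /= !AE// /nxt /=.
transitivity (L 3%N *m (P 1%N *m L 1%N) *m (P 2%N *m L 2%N) *m (P 3%N *m L 3%N) *m P 1%N).
  by rewrite !mulmxA.
by rewrite !PL// CK D3 !mulmxA !cancel.
Qed.

(** Six is the length at which every cyclic word contains 3, 1, 2, 3 consecutively, whatever the
    initial phase; the other letters are absorbed by the eigenvector relations. *)
Lemma cyc_A6 i : phase i ->
  A i *m A (nxt i) *m A (nxt (nxt i)) *m A (nxt (nxt (nxt i))) *m A (nxt (nxt (nxt (nxt i))))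
    *m A (nxt (nxt (nxt (nxt (nxt i))))) = cyc_Psi i *m dpow delta 6 *m cyc_V i.
Proof.
have p1 : phase 1%N by constructor 1.
have p2 : phase 2%N by constructor 2.
have p3 : phase 3%N by constructor 3.
have a1 : A 1%N *m cyc_Psi 2%N = cyc_Psi 1%N *m D by exact: cyc_APsi p1.
have a2 : A 2%N *m cyc_Psi 3%N = cyc_Psi 2%N *m D by exact: cyc_APsi p2.
have v1 : cyc_V 1%N *m A 1%N = D *m cyc_V 2%N by exact: cyc_VA p1.
have v2 : cyc_V 2%N *m A 2%N = D *m cyc_V 3%N by exact: cyc_VA p2.
have Dd q k (X : 'M[R]_(q, m)) : X *m D *m dpow delta k = X *m dpow delta k.+1.
  by rewrite -mulmxA dpowD.
have dD q k (X : 'M[R]_(q, m)) : X *m dpow delta k *m D = X *m dpow delta k.+1.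
  by rewrite -mulmxA dpowD addn1.
have a4 := A4.
case=> ->; rewrite /nxt /=; move: a4 a1 a2 v1 v2;
  move: (cyc_Psi 1%N) (cyc_Psi 2%N) (cyc_Psi 3%N) (cyc_V 1%N) (cyc_V 2%N) (cyc_V 3%N)
    => Q1 Q2 Q3 V1 V2 V3 a4 a1 a2 v1 v2.
- transitivity (A 1%N *m (A 2%N *m (A 3%N *m A 1%N *m A 2%N *m A 3%N))); first by rewrite !mulmxA.
  by rewrite a4 !mulmxA -[A 1%N *m A 2%N *m _]mulmxA a2 mulmxA a1 !Dd.
- transitivity (A 2%N *m (A 3%N *m A 1%N *m A 2%N *m A 3%N) *m A 1%N); first by rewrite !mulmxA.
  by rewrite a4 !mulmxA a2 -[_ *m V1 *m _]mulmxA v1 !mulmxA Dd dD.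
- rewrite a4 -[_ *m V1 *m _]mulmxA v1 !mulmxA -[_ *m V2 *m _]mulmxA v2.
  by rewrite !mulmxA !dD.
Qed.

End CyclicFactorization.

(** * The example *)

Section NatMatrices.
Variable R : realType.

(** Integer matrices are kept as functions on [nat], so that identities between them are decided by
    computation and then transferred to [R]. *)
Definition natmx a b (f : nat -> nat -> nat) : 'M[R]_(a, b) := \matrix_(i, j) (f i j)%:R.

Definition natprod (b : nat) (f g : nat -> nat -> nat) (i k : nat) : nat :=
  sumn [seq (f i j * g j k)%N | j <- iota 0 b].

Definition nateq (a b : nat) (f g : nat -> nat -> nat) : bool :=
  all (fun i => all (fun j => f i j == g i j) (iota 0 b)) (iota 0 a).

Lemma sumn_iota n (F : nat -> nat) : sumn [seq F j | j <- iota 0 n] = (\sum_(j < n) F j)%N.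
Proof. by rewrite sumnE big_map -{1}[n]subn0 -/(index_iota 0 n) big_mkord. Qed.

Lemma natmx_mul a b c f g : natmx a b f *m natmx b c g = natmx a c (natprod b f g).
Proof.
apply/matrixP => i k; rewrite !mxE /natprod sumn_iota natr_sum.
by apply: eq_bigr => j _; rewrite !mxE natrM.
Qed.

Lemma nateqP a b f g : nateq a b f g -> forall i j, (i < a)%N -> (j < b)%N -> f i j = g i j.
Proof.
move=> /allP h i j ia jb; have /h/allP : i \in iota 0 a by rewrite mem_iota.
by move=> /(_ j); rewrite mem_iota => /(_ jb)/eqP.
Qed.

Lemma natmx_eq a b f g : nateq a b f g -> natmx a b f = natmx a b g.
Proof. by move=> /nateqP h; apply/matrixP => i j; rewrite !mxE h. Qed.

Lemma natmx_scale3 n (a : R) f g h p : nateq n n (natprod n (natprod n f g) h) p ->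
  (a *: natmx n n f) *m (a *: natmx n n g) *m (a *: natmx n n h) = a ^+ 3 *: natmx n n p.
Proof.
move=> e; rewrite -!scalemxAr -!scalemxAl !scalerA !natmx_mul (natmx_eq e).
by congr (_ *: _); ring.
Qed.

(** With [N = L P] and [S = P L] one has [N^3 + N = L (S^2 + 1) P], and the hypotheses make this
    twice the all-ones matrix. *)
Lemma scaled_cube M n (L : 'M[R]_(M, n)) (P : 'M[R]_(n, M)) (T : 'M[R]_n) :
  P *m L *m (P *m L) + 1%:M = T -> L *m T *m P = 2 *: const_mx 1 ->
  forall A, A = 3^-1 *: (L *m P) -> 27 *: (A *m A *m A) + 3 *: A = 2 *: const_mx 1.
Proof.
move=> TE LTP A ->; rewrite -LTP -TE mulmxDr mulmx1 mulmxDl !mulmxA.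
rewrite -!scalemxAr -!scalemxAl !scalerA !mulmxA.
by congr (_ + _); rewrite -[RHS]scale1r; congr (_ *: _); field.
Qed.

(** As the row sums are 1, a left eigenvector for [l <> 1] has entries adding up to 0. The
    right-hand side then kills it, so [27 l^3 + 3 l = 0], and a nonzero [l] satisfies
    [l^2 = -1/9]. *)
Lemma spectrum_of_cube M (A : 'M[R]_M) : A *m const_mx 1 = const_mx 1 :> 'M[R]_M ->
  27 *: (A *m A *m A) + 3 *: A = 2 *: const_mx 1 -> no_exc_eigenvalue A 3^-1.
Proof.
move=> AJ cube l /eigenvalueP[v vA v0].
have fE : (fun r : R => (r%:C)%C) = real_complex R by [].
rewrite fE in vA; set A' := map_mx _ _ in vA.
have vJ : v *m A' *m const_mx 1 = v *m (const_mx 1 : 'M[R[i]]_M).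
  by rewrite -mulmxA /A' -(map_const_mx (real_complex R)) -map_mxM AJ.
have [->|l1] := eqVneq l 1; [by left|right].
have vJ0 : v *m (const_mx 1 : 'M[R[i]]_M) = 0.
  have : (l - 1) *: (v *m (const_mx 1 : 'M[R[i]]_M)) = 0.
    by rewrite scalerBl scale1r -{2}vJ vA scalemxAl subrr.
  by move/eqP; rewrite scaler_eq0 subr_eq0 (negPf l1) => /eqP.
have H : (27 * l ^+ 3 + 3 * l) *: v = 0.
  have := congr1 (fun X => v *m map_mx (real_complex R) X) cube.
  rewrite map_mxD !map_mxZ !map_mxM -/A' map_const_mx mulmxDr -!scalemxAr !mulmxA vA -!scalemxAl vA.
  rewrite -!scalemxAl vA vJ0 scaler0 !scalerA -scalerDl !rmorph_nat => <-.
  by congr (_ *: _); ring.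
have {H} : l * (9 * l ^+ 2 + 1) = 0.
  move/eqP: H; rewrite scaler_eq0 (negPf v0) orbF => /eqP H.
  by apply: (@mulfI _ 3); rewrite ?pnatr_eq0// mulr0 -H; ring.
move/eqP; rewrite mulf_eq0 => /orP[/eqP->|/eqP l2].
  by rewrite normr0 lecR invr_ge0.
have l2' : `|l| ^+ 2 = ((3^-1 : R)%:C)%C ^+ 2.
  rewrite -normrX; have -> : l ^+ 2 = - ((3^-1 : R)%:C)%C ^+ 2.
    have n9 : (9 : R[i]) != 0 by rewrite pnatr_eq0.
    apply: (mulfI n9); apply/eqP; rewrite -subr_eq0 -l2 fmorphV rmorph_nat.
    by apply/eqP; field.
  by rewrite normrN normrX ger0_norm// lecR invr_ge0.
rewrite le_eqVlt; apply/orP; left; rewrite -(eqrXn2 (isT : 0 < 2)%N)//; first exact/eqP.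
by rewrite lecR invr_ge0.
Qed.

End NatMatrices.

(* The block [b] of the [i]-th lumping consists of the cells listed at positions [3b], [3b+1],
   [3b+2] of [order_tab i]; the map [T_i] stretches the cell [j] over the block number
   [nth 0 (dest_tab i) j] of the next lumping. *)
Definition order_tab (i : nat) : seq nat := nth [::]
  [:: [::];
      [:: 0; 1; 2; 3; 4; 5; 6; 7; 8; 9; 10; 11; 12; 13; 14];
      [:: 1; 2; 7; 6; 11; 13; 0; 4; 9; 3; 8; 10; 5; 12; 14];
      [:: 0; 6; 8; 5; 7; 10; 1; 4; 14; 9; 12; 13; 2; 3; 11]]%N i.

Definition dest_tab (i : nat) : seq nat := nth [::]
  [:: [::];
      [:: 4; 4; 0; 0; 3; 2; 0; 2; 4; 3; 3; 2; 1; 1; 1];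
      [:: 2; 3; 4; 3; 1; 1; 0; 4; 4; 0; 3; 2; 0; 2; 1];
      [:: 0; 4; 3; 1; 4; 2; 0; 0; 3; 2; 1; 1; 3; 2; 4]]%N i.

Definition tau (i p : nat) : nat :=
  nth 0%N (order_tab (nxt i)) (3 * nth 0%N (dest_tab i) (p %/ 3) + p %% 3).

(** In the notation of the overview, [dest_ind i] is [L_i], [block_ind i] is [R_i], [lump i] is
    [C_i], [trans i] is [N_i], and [colump i] below is [S_i]. *)
Definition dest_ind (i j b : nat) : nat := nth 0%N (dest_tab i) j == b.
Definition block_ind (i b k : nat) : nat := (index k (order_tab i) %/ 3)%N == b.
Definition lump (i : nat) : nat -> nat -> nat := natprod 15 (block_ind i) (dest_ind i).
Definition trans (i : nat) : nat -> nat -> nat := natprod 5 (dest_ind i) (block_ind (nxt i)).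

Definition lump_prod (a b : nat) : nat := nth 0%N (nth [::]
  [:: [:: 8; 8; 6; 5; 0]; [:: 3; 7; 7; 7; 3]; [:: 7; 7; 5; 5; 3]; [:: 3; 5; 9; 7; 3];
      [:: 6; 0; 0; 3; 18]]%N a) b.

Lemma phaseP i : phase i -> i \in [:: 1; 2; 3]%N.
Proof. by case=> ->. Qed.

Lemma tau_lt i p : phase i -> (p < 3 * 15)%N -> (tau i p < 15)%N.
Proof.
move=> ip pK; have : all (fun i => all (fun p => (tau i p < 15)%N) (iota 0 45)) [:: 1; 2; 3]%N.
  by vm_compute.
by move=> /allP/(_ _ (phaseP ip))/allP; apply; rewrite mem_iota.
Qed.

Lemma tau_fibre i k : phase i -> (k < 15)%N -> (\sum_(p < 3 * 15) (tau i p == k) = 3)%N.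
Proof.
move=> ip kK.
have : all (fun i => all (fun k => sumn [seq (tau i p == k) : nat | p <- iota 0 (3 * 15)] == 3%N)
    (iota 0 15)) [:: 1; 2; 3]%N by vm_compute.
move=> /allP/(_ _ (phaseP ip))/allP/(_ k); rewrite mem_iota => /(_ kK)/eqP h.
by rewrite -(sumn_iota _ (fun p => nat_of_bool (tau i p == k))).
Qed.

Lemma trans_count i j k : phase i -> (j < 15)%N -> (k < 15)%N ->
  (\sum_(p < 3 * 15 | tau i p == k) (p %/ 3 == j))%N = trans i j k.
Proof.
move=> ip jK kK.
have : all (fun i => nateq 15 15 (fun j k => sumn [seq ((tau i p == k) * (p %/ 3 == j))%N
    | p <- iota 0 (3 * 15)]) (trans i)) [:: 1; 2; 3]%N by vm_compute.
move=> /allP/(_ _ (phaseP ip))/nateqP/(_ j k jK kK) <-; rewrite sumn_iota big_mkcond/=.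
by apply: eq_bigr => p _; case: eqP => _; rewrite ?mul1n.
Qed.

Lemma lump_prodE : nateq 5 5 (natprod 5 (natprod 5 (lump 1) (lump 2)) (lump 3)) lump_prod.
Proof. by vm_compute. Qed.

Definition colump (i : nat) : nat -> nat -> nat := natprod 15 (block_ind (nxt i)) (dest_ind i).

Lemma colump_sqr i : phase i ->
  nateq 5 5 (fun a b => natprod 5 (colump i) (colump i) a b + (a == b))%N (fun _ _ => 2).
Proof. by case=> ->; vm_compute. Qed.

Lemma dest_block_const i : phase i ->
  nateq 15 15 (natprod 5 (natprod 5 (dest_ind i) (fun _ _ => 2)) (block_ind (nxt i))) (fun _ _ => 2).
Proof. by case=> ->; vm_compute. Qed.

Lemma trans_row_sum i : phase i ->
  nateq 15 15 (natprod 15 (trans i) (fun _ _ => 1%N)) (fun _ _ => 3).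
Proof. by case=> ->; vm_compute. Qed.

(** * Eigenvectors and rates of the concrete matrices *)

Section Concrete.
Variable R : realType.

Definition Lmx (i : nat) : 'M[R]_(15, 5) := natmx R 15 5 (dest_ind i).
Definition Pmx (i : nat) : 'M[R]_(5, 15) := 3^-1 *: natmx R 5 15 (block_ind i).
Definition Amx (i : nat) : 'M[R]_15 := tmat R 15 (tau i).

Lemma Amx_natmx i : phase i -> Amx i = 3^-1 *: natmx R 15 15 (trans i).
Proof.
move=> ip; apply/matrixP => j k; rewrite !mxE; congr (_ * _).
by rewrite -trans_count// natr_sum.
Qed.

Lemma AmxE i : phase i -> Amx i = Lmx i *m Pmx (nxt i).
Proof. by move=> ip; rewrite Amx_natmx// /Lmx /Pmx -scalemxAr natmx_mul. Qed.

Lemma Pmx_Lmx i : Pmx i *m Lmx i = 3^-1 *: natmx R 5 5 (lump i).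
Proof. by rewrite /Pmx /Lmx -scalemxAl natmx_mul. Qed.

Lemma lump_cycle : Pmx 1 *m Lmx 1 *m (Pmx 2 *m Lmx 2) *m (Pmx 3 *m Lmx 3) =
  3^-1 ^+ 3 *: natmx R 5 5 lump_prod.
Proof.
apply: etrans (natmx_scale3 _ lump_prodE).
exact: (congr2 mulmx (congr2 mulmx (Pmx_Lmx 1) (Pmx_Lmx 2)) (Pmx_Lmx 3)).
Qed.

Lemma Amx_no_exc_eigenvalue i : phase i -> no_exc_eigenvalue (Amx i) 3^-1.
Proof.
move=> ip; have AE := Amx_natmx ip; apply: spectrum_of_cube.
  rewrite AE; have -> : const_mx 1 = natmx R 15 15 (fun _ _ => 1%N) by apply/matrixP => a b; rewrite !mxE.
  rewrite -scalemxAl natmx_mul (natmx_eq _ (trans_row_sum ip)).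
  by apply/matrixP => a b; rewrite !mxE mulVf.
apply: (@scaled_cube R 15 5 (Lmx i) (natmx R 5 15 (block_ind (nxt i))) (natmx R 5 5 (fun _ _ => 2))).
- rewrite /Lmx natmx_mul natmx_mul -(natmx_eq _ (colump_sqr ip)); apply/matrixP => a b.
  by rewrite !mxE natrD.
- rewrite /Lmx natmx_mul natmx_mul (natmx_eq _ (dest_block_const ip)).
  by apply/matrixP => a b; rewrite !mxE mulr1.
- by rewrite AE /Lmx natmx_mul.
Qed.

Let r : R := Num.sqrt 11.
Let r2 : r * r = 11. Proof. by rewrite -expr2 sqr_sqrtr. Qed.
(** The entries of the spectral product reach degree three in [r]; with the squares and cubes known,
    the identities become linear in the monomials. *)
Let r3 : r * r * r = 11 * r. Proof. by rewrite r2. Qed.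

Lemma sqrt11_bounds : 3 < r < 4.
Proof.
have r0 : 0 <= r by exact: sqrtr_ge0.
by apply/andP; split; rewrite ltNge; apply/negP => h; move: r2; nra.
Qed.

Definition spec (j : 'I_4) : R := nth 0 [:: 27; 8 + 2 * r; 2; 8 - 2 * r] j.
(** Rate per step: the cube root spreads an eigenvalue of the integer cycle over three steps, and 3
    is the scaling of each matrix. *)
Definition expo (j : 'I_4) : R := spec j `^ 3^-1 / 3.

(* The rows of [Umx] are left eigenvectors of the lumped cycle for the eigenvalues [spec], the
   columns of [Utmx] the right eigenvectors, normalised to be dual; the eigenvalue 0 is left out. *)
Definition Umx : 'M[R]_(4, 5) := \matrix_(i, j) nth 0 (nth [::]
  [:: [:: 1; 1; 1; 1; 1];
      [:: 7 - 2 * r; 2 - r; 2 * r - 8; r - 4; 3];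
      [:: 13; 3; - 12; - 7; 3];
      [:: 7 + 2 * r; 2 + r; - 2 * r - 8; - r - 4; 3]] i) j.

Definition Utmx : 'M[R]_(5, 4) := \matrix_(i, j) nth 0 (nth [::]
  [:: [:: 5^-1; (11 * r - 99) / 440; 7 / 20; (- 11 * r - 99) / 440];
      [:: 5^-1; (88 - 32 * r) / 440; - 8 / 20; (88 + 32 * r) / 440];
      [:: 5^-1; (- 22 - 2 * r) / 440; 2 / 20; (- 22 + 2 * r) / 440];
      [:: 5^-1; (14 * r - 66) / 440; 2 / 20; (- 14 * r - 66) / 440];
      [:: 5^-1; (99 + 9 * r) / 440; - 3 / 20; (99 - 9 * r) / 440]] i) j.

Lemma Umx_Utmx : Umx *m Utmx = 1%:M.
Proof.
apply/matrixP => i j; rewrite mxE !big_ord_recl big_ord0 !mxE /=.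
by case: i => [[|[|[|[|//]]]] ip]; case: j => [[|[|[|[|//]]]] jp] /=; move: r2; lra.
Qed.

Lemma lump_prod_spectral :
  natmx R 5 5 lump_prod = Utmx *m diag_mx (\row_j spec j) *m Umx.
Proof.
apply/matrixP => i j; rewrite [RHS]mxE !big_ord_recl big_ord0 mul_mx_diag !mxE /spec /lump_prod /=.
by case: i => [[|[|[|[|[|//]]]]] ip]; case: j => [[|[|[|[|[|//]]]]] jp] /=; move: r2 r3; lra.
Qed.

(** This puts all four rates above the threshold 1/3; the tightest case is [8 - 2 sqrt 11], about
    1.37. *)
Lemma spec_gt1 j : 1 < spec j.
Proof.
have /andP[h1 h2] := sqrt11_bounds; rewrite /spec; move: r2.
by case: j => [[|[|[|[|//]]]] jp] /=; nra.
Qed.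

Lemma spec_strict (i j : 'I_4) : (i < j)%N -> spec j < spec i.
Proof.
have /andP[h1 h2] := sqrt11_bounds; rewrite /spec; move: r2.
by case: i => [[|[|[|[|//]]]] ip]; case: j => [[|[|[|[|//]]]] jp] //= _ _; nra.
Qed.

Lemma expo_gt j : 3^-1 < expo j.
Proof.
rewrite /expo -[X in X < _]mul1r ltr_pM2r ?invr_gt0//.
have e : (1 : R) `^ 3^-1 = 1 by rewrite powR1.
rewrite -[X in X < _]e.
by apply: gt0_ltr_powR; rewrite ?invr_gt0 ?nnegrE ?spec_gt1// ltW// (lt_trans ltr01)// spec_gt1.
Qed.

Lemma expo_strict (i j : 'I_4) : (i < j)%N -> expo j < expo i.
Proof.
move=> ij; rewrite /expo ltr_pM2r ?invr_gt0//.
by apply: gt0_ltr_powR; rewrite ?invr_gt0 ?nnegrE ?spec_strict// ltW// (lt_trans ltr01)// spec_gt1.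
Qed.

Lemma expo_cube j : expo j ^+ 3 = spec j / 27.
Proof.
have s0 : 0 <= spec j by rewrite ltW// (lt_trans ltr01)// spec_gt1.
rewrite /expo expr_div_n -powR_mulrn ?powR_ge0// -powRrM mulVf// powRr1//.
by congr (_ / _); ring.
Qed.

Lemma expo0 : expo ord0 = 1.
Proof.
rewrite /expo /spec /= (_ : 27 = 3 `^ 3%:R :> R); last by rewrite powR_mulrn//; ring.
by rewrite -powRrM mulfV// powRr1// divff.
Qed.

Lemma lump_cycle_spectral : Pmx 1 *m Lmx 1 *m (Pmx 2 *m Lmx 2) *m (Pmx 3 *m Lmx 3) =
  Utmx *m dpow expo 3 *m Umx.
Proof.
apply: (etrans lump_cycle); apply: (etrans (congr1 _ lump_prod_spectral)).
have -> : dpow expo 3 = 3^-1 ^+ 3 *: diag_mx (\row_j spec j).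
  apply/matrixP => i j; rewrite !mxE expo_cube.
  by case: eqVneq => [->|_]; rewrite ?mulr0n ?mulr0// !mulr1n mulrC; congr (_ * _); field.
by rewrite -scalemxAr -scalemxAl.
Qed.

End Concrete.

Lemma Omega3_offset w : Omega3 w -> exists s : nat, forall n : nat, w n%:Z = ((n + s) %% 3).+1.
Proof.
have a n : alpha_seq n%:Z = (n %% 3).+1 by rewrite /alpha_seq modz_nat.
have S n : n%:Z + 1 = n.+1%:Z by rewrite -PoszD addn1.
case=> [->|[->|->]]; [exists 0%N|exists 1%N|exists 2%N] => n.
- by rewrite a addn0.
- by rewrite /sshift S a addn1.
- by rewrite /sshift !S a addn2.
Qed.

Lemma Omega3_phase w : Omega3 w -> forall n : nat,
  phase (w n%:Z) /\ w n.+1%:Z = nxt (w n%:Z).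
Proof.
move=> /Omega3_offset[s wE] n; rewrite !wE /nxt; split.
  have : ((n + s) %% 3 < 3)%N by rewrite ltn_pmod.
  by case: (_ %% 3)%N => [|[|[|//]]] _; [constructor 1|constructor 2|constructor 3].
by rewrite -[((n + s) %% 3).+1]addn1 modnDml addn1 addSn.
Qed.

(** * The cocycle over the periodic orbit *)

Section CyclicSystem.
Variables (R : realType) (M m : nat) (t : nat -> nat -> nat).
Hypothesis m_lt : (m < M)%N.
Hypothesis t_lt : forall i, phase i -> forall p, (p < 3 * M)%N -> (t i p < M)%N.

Let T i := @bmap R M (t i).
Let d i := bdata R M (t i).
Let A i : 'M[R]_M := tmat R M (t i).

Variables (Psi : nat -> 'M[R]_(M, m)) (V : nat -> 'M[R]_(m, M)) (delta : 'I_m -> R).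
Hypothesis delta_gt : forall j, 3^-1 < delta j.
Hypothesis delta_strict : forall i j : 'I_m, (i < j)%N -> delta j < delta i.
Hypothesis APsi : forall i, phase i -> A i *m Psi (nxt i) = Psi i *m dpow delta 1.
Hypothesis VA : forall i, phase i -> V i *m A i = dpow delta 1 *m V (nxt i).
Hypothesis VPsi : forall i, phase i -> V i *m Psi i = 1%:M.
Hypothesis A6 : forall i, phase i ->
  A i *m A (nxt i) *m A (nxt (nxt i)) *m A (nxt (nxt (nxt i))) *m A (nxt (nxt (nxt (nxt i))))
    *m A (nxt (nxt (nxt (nxt (nxt i))))) = Psi i *m dpow delta 6 *m V i.

Let B : R := 1 + \sum_(i < 4) (nrm (A i) + nrm (Psi i) + nrm (V i)).

Let B_gt0 : 0 < B.
Proof. by rewrite ltr_pwDl// sumr_ge0// => i _; rewrite !addr_ge0 ?nrm_ge0. Qed.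

Let B_ge i : phase i -> [/\ nrm (A i) <= B, nrm (Psi i) <= B & nrm (V i) <= B].
Proof.
move=> ip; have i4 : (i < 4)%N by case: ip => ->.
have h : nrm (A i) + nrm (Psi i) + nrm (V i) <= B.
  rewrite /B (bigD1 (Ordinal i4))//= addrCA lerDl addr_ge0// sumr_ge0// => k _.
  by rewrite !addr_ge0 ?nrm_ge0.
have a := nrm_ge0 (A i); have b := nrm_ge0 (Psi i); have c := nrm_ge0 (V i).
by split; lra.
Qed.

Lemma cyclic_ess_upper w : Omega3 w -> ess_upper T d w = (ln 3^-1)%:E.
Proof.
move=> Ow; apply: ess_upper_ln3; first exact: leq_ltn_trans m_lt.
by move=> n; apply: t_lt; have [] := Omega3_phase Ow n.
Qed.

Lemma cyclic_exc_spectrum w : Omega3 w ->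
  exc_spectrum T d w = [set x | exists j, delta j < 1 /\ x = (ln (delta j))%:E].
Proof.
move=> Ow; have wp n := (Omega3_phase Ow n).1; have wS n := (Omega3_phase Ow n).2.
apply: (@exc_spectrumE R M t _ w _ m Psi V delta B) => //.
- exact: leq_ltn_trans m_lt.
- by move=> n; exact: t_lt.
- move=> i j; rewrite leq_eqVlt => /orP[/eqP/val_inj->//|ij]; exact/ltW/delta_strict.
- by move=> n; rewrite wS; exact: APsi.
- by move=> n; exact: VPsi.
- move=> n; rewrite -A6// -!wS /= !mul1mx.
  by rewrite addn0 addn1 addn2 addn3 addn4 (addnS n 4) addn4.
- by move=> n; exact: B_ge.
- exact: cyclic_ess_upper.
Qed.

Lemma cyclic_oseledets :
  oseledets A Omega3 m.+1 (osel_exponent delta) (fun w => osel_space Psi V (w 0)).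
Proof.
apply: (@oseledets_spaces R M m A Psi V delta B) => //.
- by move=> j; apply: lt_trans (delta_gt j); rewrite invr_gt0.
- move=> w Ow n; have [wp wS] := Omega3_phase Ow n; rewrite wS; exact: APsi.
- move=> w Ow n; have [wp wS] := Omega3_phase Ow n; rewrite wS; exact: VA.
- move=> w Ow n; have [wp _] := Omega3_phase Ow n; exact: VPsi.
- move=> w Ow; have wp := (Omega3_phase Ow 0).1; have wS n := (Omega3_phase Ow n).2.
  by rewrite -[w 0]/(w 0%:Z) -A6// -!wS /= mul1mx.
- move=> w Ow n; have [wp _] := Omega3_phase Ow n; by have [] := B_ge wp.
Qed.

End CyclicSystem.

Theorem theorem1 (R : realType) :
  exists (T : nat -> R -> R) (d : nat -> pa_data R) (Mb : nat) (b : nat -> R)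
         (Amat : nat -> 'M[R]_Mb),
    (* B is a common Markov partition; Amat i represents P_i on chi(B) *)
    is_partition b Mb /\
    (forall i : nat, i \in [:: 1; 2; 3]%N ->
       [/\ is_pa_expanding (T i) (d i), is_markov (T i) b Mb &
           represents (T i) (d i) b (Amat i)]) /\
    (* (i) *)
    (forall i : nat, i \in [:: 1; 2; 3]%N -> preserves_leb (T i)) /\
    (* (ii) *)
    (forall w, Omega3 w -> ess_upper T d w = (ln (1 / 3 : R))%:E) /\
    (* (iii) *)
    (forall i : nat, i \in [:: 1; 2; 3]%N ->
       no_exc_eigenvalue (Amat i) (theta_map (T i) (d i))) /\
    (* (iv) *)
    (exists E : set (\bar R),
       (forall w, Omega3 w -> exc_spectrum T d w = E) /\
       E (ln ((8 + 2 * Num.sqrt 11) `^ (3^-1) / 3))%:E /\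
       E (ln ((8 - 2 * Num.sqrt 11) `^ (3^-1) / 3))%:E) /\
    (* (v) *)
    (exists (l : nat) (lam : nat -> \bar R) (W : (int -> nat) -> nat -> 'M[R]_Mb),
       [/\ (1 < l)%N, oseledets Amat Omega3 l lam W,
           (forall w, Omega3 w ->
              exc_spectrum T d w (lam 1%N) /\
              forall mu, exc_spectrum T d w mu -> (mu <= lam 1%N)%E) &
           exists F : nat -> 'M[R]_Mb,
             forall w, Omega3 w -> (W w 1%N :=: F (w 0))%MS]).
Proof.
pose delta := @expo R; pose C i := Pmx R i *m Lmx R i.
pose Psi := cyc_Psi (Lmx R) (Utmx R) delta C.
pose V := cyc_V (Pmx R) (Umx R) delta C.
have ph i : i \in [:: 1; 2; 3]%N -> phase i.
  by rewrite !inE => /or3P[] /eqP ->; [constructor 1|constructor 2|constructor 3].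
have tlt i : phase i -> forall p, (p < 3 * 15)%N -> (tau i p < 15)%N by move=> ip p; exact: tau_lt.
have dgt := @expo_gt R : forall j, 3^-1 < delta j.
have dstr := @expo_strict R : forall i j : 'I_4, (i < j)%N -> delta j < delta i.
have d0 j : 0 < delta j by apply: lt_trans (dgt j); rewrite invr_gt0.
have PL i : phase i -> Pmx R i *m Lmx R i = C i by [].
have AE := @AmxE R; have UU := Umx_Utmx R; have CE := lump_cycle_spectral R.
have APsi i (ip : phase i) := cyc_APsi PL AE d0 UU CE ip.
have VA i (ip : phase i) := cyc_VA PL AE d0 UU CE ip.
have VPsi i (ip : phase i) := cyc_VPsi PL d0 UU CE ip.
have A6 i (ip : phase i) := cyc_A6 PL AE d0 UU CE ip.
have m15 : (4 < 15)%N by [].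
have EU w Ow := @cyclic_ess_upper R 15 4 tau m15 tlt w Ow.
have ES w Ow := @cyclic_exc_spectrum R 15 4 tau m15 tlt Psi V delta dgt dstr APsi VPsi A6 w Ow.
have OS := @cyclic_oseledets R 15 4 tau m15 Psi V delta dgt dstr APsi VA VPsi A6.
have M0 : (0 < 15)%N by [].
exists (fun i => bmap 15 (tau i)), (fun i => bdata R 15 (tau i)), 15%N, (breaks R 15), (Amx R).
(* The rate of index 0 equals 1, the exponent 0, which is not exceptional; the other three are. *)
have dlt1 (j : 'I_4) : delta j < 1 -> (0 < j)%N.
  rewrite lt0n; apply: contraTneq => j0.
  by rewrite (_ : j = ord0) ?/delta ?expo0 ?ltxx//; exact: val_inj.
have lt1d (j : 'I_4) : (0 < j)%N -> delta j < 1.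
  by move=> j0; rewrite -(expo0 R); exact: expo_strict.
(* The positions of [8 + 2 sqrt 11] and [8 - 2 sqrt 11] in [spec]. *)
pose j1 : 'I_4 := Ordinal (isT : 1 < 4)%N; pose j3 : 'I_4 := Ordinal (isT : 3 < 4)%N.
split; first exact: breaks_partition.
split.
  move=> i /ph ip; split.
  - exact: bmap_expanding M0 (tlt i ip).
  - by apply: bmap_markov.
  - by apply: tmat_represents.
split.
  by move=> i /ph ip; apply: bmap_preserves_leb => // k; [exact: tlt|exact: tau_fibre].
split; first by move=> w Ow; rewrite div1r; exact: EU.
split.
  by move=> i /ph ip; rewrite theta_map_bmap//; [exact: Amx_no_exc_eigenvalue|exact: tlt].
split.
  exists [set x | exists j, delta j < 1 /\ x = (ln (delta j))%:E]; split; first exact: ES.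
  by split; [exists j1|exists j3]; split => //; exact: lt1d.
have l1 : osel_exponent delta 1 = (ln (delta j1))%:E by rewrite -[1%N]/(nat_of_ord j1) /osel_exponent valK.
(* A line for each of the four rates and the subspace with exponent minus infinity; all are built
   from the symbol [w 0] alone. *)
exists 5%N, (osel_exponent delta), (fun w => osel_space Psi V (w 0)); split => //.
  move=> w Ow; rewrite (ES w Ow) l1; split; first by exists j1; split => //; exact: lt1d.
  move=> _ [j [/dlt1 j0 ->]]; rewrite lee_fin ler_ln ?posrE//.
  have [->//|jj] := eqVneq j j1; apply/ltW/dstr.
  by move: jj j0; rewrite -val_eqE/=; lia.
by exists (fun i => osel_space Psi V i 1).
Qed.
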